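(* Let $X$ be an infinite compact metrizable abelian group, let $\mathfrak u_0$ be the topology induced on $c_0(X)$ by the uniform topology of $X^{\mathbb N}$, and let $G:=(c_0(X),\mathfrak u_0)$. Then $G$ is a nonprecompact locally quasi-convex Polish group. Further, the following assertions are equivalent: (i) $X$ is connected. (ii) $G^\wedge=(X^\wedge)^{(\mathbb N)}$. (iii) $\mathrm{Card}\, G^\wedge=\aleph_0$. (iv) $\mathrm{Card}\, G^\wedge<\mathfrak c$.
   Context: $\mathfrak c$ is the cardinality of the continuum. $\mathbb S=\{s\in\mathbb C:|s|=1\}$, $\mathbb S_+=\{s\in\mathbb S:\mathrm{Re}(s)\ge 0\}$. For a topological abelian group $X$, $X^\wedge$ is the group of all continuous homomorphisms $X\to\mathbb S$ under pointwise multiplication. Precompact means totally bounded. $X^{\mathbb N}$ is the group of all sequences in $X$; $c_0(X)$ is its subgroup of sequences converging to the neutral element $0$ of $X$. The uniform topology on $X^{\mathbb N}$ is the group topology having $\{V^{\mathbb N}: V \text{ a neighborhood of } 0 \text{ in } X\}$ as a basis of neighborhoods at the neutral element. $(X^\wedge)^{(\mathbb N)}$ is the group of sequences $(\xi_n)_{n\in\mathbb N}$ in $X^\wedge$ with $\xi_n=1$ for all but finitely many $n$. Each $\mathbf h=(\xi_n)\in (X^\wedge)^{(\mathbb N)}$ defines a continuous character $\chi_{\mathbf h}((x_n))=\prod_n\xi_n(x_n)$ of $G$, and $\mathbf h\mapsto\chi_{\mathbf h}$ is an injective homomorphism $(X^\wedge)^{(\mathbb N)}\to G^\wedge$; the equality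 $G^\wedge=(X^\wedge)^{(\mathbb N)}$ means that this homomorphism is onto, i.e. every continuous character of $G$ has the form $\chi_{\mathbf h}$ with $\mathbf h\in (X^\wedge)^{(\mathbb N)}$. A subset $A$ of a topological abelian group $G$ is quasi-convex if for every $x\in G\setminus A$ there is $\chi\in G^\wedge$ with $\chi(A)\subset\mathbb S_+$ and $\chi(x)\notin\mathbb S_+$; $G$ is locally quasi-convex if the neighborhoods of the neutral element have a basis of quasi-convex sets. *)

(* Defs.v *)
From HB Require Import structures.
From mathcomp Require Import all_boot all_order all_algebra.
From mathcomp Require Import all_classical all_reals all_analysis.
From mathcomp Require Import complex.

Set Implicit Arguments.
Unset Strict Implicit.
Unset Printing Implicit Defensive.

Import Order.TTheory GRing.Theory Num.Theory.

Local Open Scope classical_set_scope.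
Local Open Scope ring_scope.

(* [metric_for d]: d is a metric on T inducing the given topology of T. *)
Definition metric_for (R : realType) (T : topologicalType) (d : T -> T -> R) :=
  [/\ forall x y, d x y = 0 <-> x = y,
      forall x y, d x y = d y x,
      forall x y z, d x z <= d x y + d y z &
      forall x, nbhs x = nbhs_ball_ (fun y e => [set z | d y z < e]) x].

Definition complete_metric (R : realType) (T : topologicalType)
    (d : T -> T -> R) :=
  forall u : nat -> T,
    (forall e, 0 < e -> exists N : nat, forall m n : nat,
       (N <= m)%N -> (N <= n)%N -> d (u m) (u n) < e) ->
    exists l : T, u @ \oo --> l.

Definition metrizable (R : realType) (T : topologicalType) :=
  exists d : T -> T -> R, metric_for d.

Definition separable (T : topologicalType) :=
  exists2 A : set T, countable A & dense A.

Definition polish (R : realType) (T : topologicalType) :=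
  separable T /\ exists2 d : T -> T -> R, metric_for d & complete_metric d.

Definition precompact_group (G : topologicalZmodType) :=
  forall U : set G, nbhs (0 : G) U ->
    exists2 F : set G, finite_set F &
      [set: G] = [set x + y | x in F & y in U].

Definition circle (R : realType) : set R[i] := [set z | `|z| = 1].

Definition circle_pos (R : realType) : set R[i] :=
  [set z | circle z /\ 0 <= complex.Re z].

(* The dual group as a set of complex-valued functions; [R[i]^o] carries the
   topology given by the modulus. *)
Definition dual (R : realType) (G : topologicalZmodType) : set (G -> R[i]) :=
  [set chi | [/\ continuous (chi : G -> R[i]^o),
                 forall x, circle (chi x) &
                 forall x y, chi (x + y) = chi x * chi y]].

Definition quasi_convex (R : realType) (G : topologicalZmodType) (A : set G) :=
  forall x : G, ~ A x ->
    exists2 chi, dual (R := R) chi &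
      chi @` A `<=` @circle_pos R /\ ~ circle_pos (chi x).

Definition locally_quasi_convex (R : realType) (G : topologicalZmodType) :=
  forall U : set G, nbhs (0 : G) U ->
    exists V : set G, [/\ nbhs (0 : G) V, V `<=` U & quasi_convex R V].

(* An alias of [nat -> X], kept apart because [nat -> X] carries other
   topologies in the library. *)
Definition uniform_seq (X : topologicalZmodType) : Type := nat -> X.

Section uniform_seq.
Variable X : topologicalZmodType.
Local Notation S := (uniform_seq X).

HB.instance Definition _ := GRing.Zmodule.copy S (nat -> X).

(* V^N translated by x, for V a neighborhood of 0, is a basic neighborhood of
   x in the uniform topology. *)
Definition unif_nbhs (x : S) : set_system S :=
  filter_from (nbhs (0 : X)) (fun V => [set y : S | forall n, V (y n - x n)]).

HB.instance Definition _ := hasNbhs.Build S unif_nbhs.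

Let unif_filter (x : S) : ProperFilter (unif_nbhs x).
Proof.
apply: filter_from_proper; last first.
  by move=> V V0; exists x => n; rewrite subrr; exact: nbhs_singleton.
apply: filter_from_filter; first by exists setT; exact: filterT.
move=> U V U0 V0; exists (U `&` V); first exact: filterI.
by move=> y UVy; split => n; case: (UVy n).
Qed.

Let unif_singleton (x : S) (A : set S) : unif_nbhs x A -> A x.
Proof. by case=> V V0; apply => n; rewrite subrr; exact: nbhs_singleton. Qed.

Lemma nbhs0_split (V : set X) : nbhs (0 : X) V ->
  exists2 W, nbhs (0 : X) W & forall a b, W a -> W b -> V (a + b) /\ V (a - b).
Proof.
move=> V0.
have [[A B]/= [A0 B0] AB] : nbhs (0 : X, 0 : X) [set z | V (z.1 + z.2)].
  by apply: add_continuous; rewrite /= addr0.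
have [[C D]/= [C0 D0] CD] : nbhs (0 : X, 0 : X) [set z | V (z.1 - z.2)].
  by apply: sub_continuous; rewrite /= subr0.
exists ((A `&` B) `&` (C `&` D)); first by do ?apply: filterI.
move=> a b [[Aa Ba] [Ca Da]] [[Ab Bb] [Cb Db]].
by split; [exact: (AB (a, b))|exact: (CD (a, b))].
Qed.

Let unif_nbhs_nbhs (x : S) (A : set S) :
  unif_nbhs x A -> unif_nbhs x (unif_nbhs^~ A).
Proof.
move=> [V V0 VA]; have [W W0 WV] := nbhs0_split V0.
exists W => // y Wy; exists W => // z Wz; apply: VA => n.
by rewrite -(subrK (y n) (z n)) -addrA; apply: (WV _ _ (Wz n) (Wy n)).1.
Qed.

HB.instance Definition _ :=
  Nbhs_isNbhsTopological.Build S unif_filter unif_singleton unif_nbhs_nbhs.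

Let unif_sub_continuous : continuous (fun z : S * S => z.1 - z.2).
Proof.
move=> [x y] A [V V0 VA]; have [W W0 WV] := nbhs0_split V0.
exists ([set z : S | forall n, W (z n - x n)],
        [set z : S | forall n, W (z n - y n)]).
  by split; exists W.
move=> [u v]/= [Wu Wv]; apply: VA => n.
have -> : (u - v : S) n - (x - y : S) n = (u n - x n) - (v n - y n).
  by change (u n - v n - (x n - y n) = u n - x n - (v n - y n));
    rewrite !opprD addrACA.
exact: (WV _ _ (Wu n) (Wv n)).2.
Qed.

HB.instance Definition _ :=
  PreTopologicalNmodule_isTopologicalZmodule.Build S unif_sub_continuous.

Definition in_c0 : {pred S} := fun x => `[< (x : nat -> X) @ \oo --> (0 : X) >].

Let in_c0_zmod : zmod_closed in_c0.
Proof.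
split; first by apply/asboolP; exact: (@cvg_cst _ (0 : X)).
move=> x y /asboolP x0 /asboolP y0; apply/asboolP.
have := @sub_continuous X (0, 0); rewrite /continuous_at /= subr0 => sub0.
exact: (@cvg_comp _ _ _ (fun n => (x n, y n)) (fun z : X * X => z.1 - z.2) \oo
  (nbhs (0 : X, 0 : X)) (nbhs (0 : X)) (cvg_pair x0 y0) sub0).
Qed.

HB.instance Definition _ := GRing.isZmodClosed.Build S in_c0 in_c0_zmod.

End uniform_seq.

(* The topological group (c_0(X), u_0). *)
Definition c0 (X : topologicalZmodType) : Type :=
  {x : uniform_seq X | x \in @in_c0 X}.

Section c0.
Variable X : topologicalZmodType.
Local Notation G := (c0 X).

HB.instance Definition _ := SubChoice.copy G {x : uniform_seq X | x \in @in_c0 X}.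
HB.instance Definition _ := [SubChoice_isSubZmodule of G by <:].
HB.instance Definition _ :=
  Topological.copy G (initial_topology (val : G -> uniform_seq X)).

Let c0_sub_continuous : continuous (fun z : G * G => z.1 - z.2).
Proof.
apply: (@continuous_comp_initial _ _ _ (val : G -> uniform_seq X)).
have valc : continuous (val : G -> uniform_seq X) by exact: initial_continuous.
move=> z; apply: (@continuous_comp (G * G)%type
  (uniform_seq X * uniform_seq X)%type (uniform_seq X)
  (fun z => (val z.1, val z.2)) (fun z => z.1 - z.2)); last first.
  exact: sub_continuous.
apply: (@cvg_pair _ _ _ (nbhs z) (nbhs (val z.1)) (nbhs (val z.2))
  _ _ _ (fun z : G * G => val z.1) (fun z => val z.2)).
  by apply: (@continuous_comp (G * G)%type G (uniform_seq X) fst val);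
    [exact: cvg_fst|exact: valc].
by apply: (@continuous_comp (G * G)%type G (uniform_seq X) snd val);
  [exact: cvg_snd|exact: valc].
Qed.

HB.instance Definition _ :=
  PreTopologicalNmodule_isTopologicalZmodule.Build G c0_sub_continuous.

End c0.

Definition finsupp_dual (R : realType) (X : topologicalZmodType) :
    set (nat -> X -> R[i]) :=
  [set h | (forall n, dual (h n)) /\ finite_set [set n | h n <> cst 1]].

(* The product over [nat] is finitely supported. *)
Definition chi_of (R : realType) (X : topologicalZmodType)
    (h : nat -> X -> R[i]) : c0 X -> R[i] :=
  fun x => \big[*%R/1]_(n \in [set: nat]) h n (val x n).

(* Main.v *)
(* Write [c0] for [c_0(X)].  Characters of [X] are produced by a hands-on
   Peter-Weyl argument.  The invariant mean of a continuous function is the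
   constant uniformly approximated by averages of finitely many translates.
   For an even continuous kernel [k], let [T] be the convolution by [k].  With
   [t n = |k^{*(n+1)}|_2^2], the sequence [t] is log-convex and
   submultiplicative, so the even convolution powers of [k], normalised by the
   growth rate [rho] of [t], form a Cauchy sequence whose limit is a nonzero
   eigenvector of [T \o T].  The eigenspace is finite dimensional and
   translation invariant, and a common eigenvector of the commuting
   translations is, up to a factor, a character.

   If [X] is connected, every neighborhood [V] of 0 generates [X] in boundedly
   many steps, so a nontrivial character of [X] is uniformly far from 1
   somewhere on [V]; a character of [c0] with infinitely many nontrivial
   components would then not be close to 1 on [V^N].  If [X] is disconnected,
   it has a nontrivial character [xi] with open kernel, and each
   [S \subset nat] gives the character [x |-> \prod_(n in S) xi (x n)]. *)

Require Import Defs.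
From mathcomp Require Import all_boot all_order all_algebra.
From mathcomp Require Import all_classical all_reals all_analysis.
From mathcomp Require Import complex.
From mathcomp Require Import ring lra zify.

Set Implicit Arguments.
Unset Strict Implicit.
Unset Printing Implicit Defensive.

Import Order.TTheory GRing.Theory Num.Theory.
Import numFieldNormedType.Exports.

Local Open Scope classical_set_scope.
Local Open Scope card_scope.
Local Open Scope ring_scope.

(** * Invariant means *)

Section averages.
Variable R : realType.

(** The group is abelian, so averages over lists of translates commute; this gives uniqueness of the
    mean and, through it, linearity and Fubini. No measure and no Hilbert space completion are
    involved, and the price is that limits are available only for the uniform norm. The convolution
    operator pays it: [conv_sup] bounds the sup norm of [T f] by quadratic norms, so a Cauchy
    estimate on inner products of convolution powers becomes uniform convergence of continuous
    functions. Even powers are taken because [T] may have two eigenvalues of opposite sign and equal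
    modulus. The fact about the circle that recurs is that its right half contains no nontrivial
    subgroup. It turns a character nontrivial at a point into one with negative real part there,
    bounds the variation of characters from below, and identifies characters that are close on a
    net. Local quasi-convexity of the group of null sequences is inherited coordinatewise from
    [X]. *)

Definition avg (G : zmodType) (s : seq G) (f : G -> R) (x : G) : R :=
  (\sum_(a <- s) f (x + a)) / (size s)%:R.

Definition is_mean (G : zmodType) (f : G -> R) (c : R) :=
  forall e, 0 < e -> exists2 s : seq G, s != [::] &
    forall x, `|avg s f x - c| <= e.

Section one_group.
Variable G : zmodType.
Implicit Types (s t : seq G) (f g : G -> R).

Lemma avgC s t f x : avg s (avg t f) x = avg t (avg s f) x.
Proof.
rewrite /avg -!mulr_suml exchange_big/= mulrAC; congr (_ / _ / _).
by apply: eq_bigr => a _; apply: eq_bigr => b _; rewrite addrAC.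
Qed.

Lemma avg_avg s t f x :
  avg s (avg t f) x = avg [seq a + b | a <- s, b <- t] f x.
Proof.
rewrite /avg -mulr_suml big_allpairs_dep/= size_allpairs mulnC natrM invfM.
rewrite mulrA; congr (_ / _ / _).
by apply: eq_bigr => a _; apply: eq_bigr => b _; rewrite addrA.
Qed.

Lemma allpairs_neq0 (H K : Type) (L : eqType) (h : H -> K -> L) (s : seq H) (t : seq K) :
  size s != 0 -> size t != 0 -> [seq h a b | a <- s, b <- t] != [::].
Proof. by case: s => //= a s; case: t. Qed.

Lemma avgD s f g x : avg s (fun y => f y + g y) x = avg s f x + avg s g x.
Proof. by rewrite /avg big_split/= mulrDl. Qed.

Lemma avgZ s k f x : avg s (fun y => k * f y) x = k * avg s f x.
Proof. by rewrite /avg -mulr_sumr mulrA. Qed.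

Lemma avg_cst s c x : s != [::] -> avg s (fun=> c) x = c.
Proof.
move=> s0; rewrite /avg big_const_seq count_predT iter_addr addr0 -[c *+ _]mulr_natr mulfK//.
by rewrite pnatr_eq0 size_eq0.
Qed.

Lemma ler_avg s f g x : (forall y, f y <= g y) -> avg s f x <= avg s g x.
Proof.
by move=> fg; rewrite /avg ler_wpM2r ?invr_ge0//; apply: ler_sum => a _.
Qed.

Lemma avg_near s f c e x : s != [::] -> (forall y, `|f y - c| <= e) ->
  `|avg s f x - c| <= e.
Proof.
move=> s0 fe; rewrite ler_norml; apply/andP; split.
  rewrite lerBrDl -[leLHS](avg_cst _ x s0); apply: ler_avg => y.
  by have := fe y; rewrite ler_norml => /andP[]; rewrite lerBrDl.
rewrite lerBlDr -[leRHS](avg_cst _ x s0); apply: ler_avg => y.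
by have := fe y; rewrite ler_norml => /andP[_]; rewrite lerBlDr.
Qed.

Lemma eq_avg s f g x : f =1 g -> avg s f x = avg s g x.
Proof. by move=> fg; rewrite /avg; under eq_bigr do rewrite fg. Qed.

(** Averaging over [s] and over [t] in either order gives the same function, near [c] for one order
    and near [d] for the other. *)
Lemma mean_unique f c d : is_mean f c -> is_mean f d -> c = d.
Proof.
move=> fc fd; apply/eqP; rewrite -subr_eq0 -normr_le0; apply/ler_addgt0Pr => e e0.
rewrite add0r.
have e20 : 0 < e / 2 by rewrite divr_gt0.
have [s s0 sc] := fc _ e20; have [t t0 td] := fd _ e20.
have h1 := avg_near 0 t0 sc; have h2 := avg_near 0 s0 td.
rewrite (avgC s t) in h2; rewrite [e]splitr -(subrKA (avg t (avg s f) 0)).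
by apply: (le_trans (ler_normD _ _)); rewrite lerD// distrC.
Qed.

Lemma mean_refine f c e : is_mean f c -> 0 < e ->
  exists2 s, s != [::] & forall t x, t != [::] -> `|avg t (avg s f) x - c| <= e.
Proof. by move=> fc /fc[s s0 sc]; exists s => // t x t0; exact: avg_near. Qed.

Lemma meanD f g c d : is_mean f c -> is_mean g d ->
  is_mean (fun x => f x + g x) (c + d).
Proof.
move=> fc gd e e0; have e20 : 0 < e / 2 by rewrite divr_gt0.
have [s s0 sc] := fc _ e20; have [t t0 td] := gd _ e20.
exists [seq a + b | a <- s, b <- t]; first by rewrite allpairs_neq0// size_eq0.
move=> x; rewrite -avg_avg (eq_avg _ _ (avgD t f g)) avgD avgC opprD addrACA.
rewrite [e]splitr.
by apply: (le_trans (ler_normD _ _)); rewrite lerD// avg_near.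
Qed.

Lemma meanZ k f c : is_mean f c -> is_mean (fun x => k * f x) (k * c).
Proof.
move=> fc e e0; have k0 : 0 < `|k| + 1 by rewrite ltr_pwDr.
have [s s0 sc] := fc (e / (`|k| + 1)) (divr_gt0 e0 k0).
exists s => // x; rewrite avgZ -mulrBr normrM.
rewrite (le_trans (ler_wpM2l _ (sc x)))// mulrCA ler_piMr ?ltW//.
by rewrite ltr_pdivrMr// mul1r ltrDl.
Qed.

Lemma mean_cst c : is_mean (fun _ : G => c) c.
Proof.
by move=> e e0; exists [:: 0] => // x; rewrite avg_cst// subrr normr0 ltW.
Qed.

Lemma mean_translate a f c : is_mean f c -> is_mean (fun x => f (x + a)) c.
Proof.
move=> fc e /fc[s s0 sc]; exists s => // x.
rewrite (_ : avg _ _ _ = avg s f (x + a))// /avg.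
by under eq_bigr do rewrite addrAC.
Qed.

Lemma mean_ge0 f c : (forall x, 0 <= f x) -> is_mean f c -> 0 <= c.
Proof.
move=> f0 fc; apply/ler_addgt0Pr => e /fc[s s0 /(_ 0)].
rewrite ler_norml => /andP[_]; rewrite lerBlDr addrC; apply: le_trans.
by rewrite -(avg_cst 0 0 s0); exact: ler_avg.
Qed.

Lemma eq_mean f g c : f =1 g -> is_mean f c -> is_mean g c.
Proof. by move=> /funext ->. Qed.

End one_group.

(** The hypothesis asks for one list [t] that serves every [x]; supplying it is the work of
    [mean_haar]. *)
Lemma mean_iterated (G H : zmodType) (F : G * H -> R) (g : G -> R) c :
    (forall e, 0 < e -> exists2 t : seq H, t != [::] &
      forall x y, `|avg t (fun y => F (x, y)) y - g x| <= e) ->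
  is_mean g c -> is_mean F c.
Proof.
move=> Fg gc e e0; have e20 : 0 < e / 2 by rewrite divr_gt0.
have [t t0 tg] := Fg _ e20; have [s s0 sc] := gc _ e20.
exists [seq (a, b) | a <- s, b <- t]; first by rewrite allpairs_neq0// size_eq0.
move=> [x y]; rewrite [e]splitr -(subrKA (avg s g x)).
apply: (le_trans (ler_normD _ _)); rewrite lerD//.
rewrite (_ : avg _ F _ = avg s (fun x => avg t (fun y => F (x, y)) y) x).
  have -> : forall u v : R, u - v = u + (-1) * v by move=> *; rewrite mulN1r.
  rewrite -avgZ -avgD -[X in `|X|]subr0; apply: avg_near => // z.
  by rewrite subr0 mulN1r.
rewrite /avg -mulr_suml big_allpairs_dep/= size_allpairs mulnC natrM invfM.
by rewrite mulrA.
Qed.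

End averages.

(** * Finite nets and uniform continuity on compact groups *)

Section compact_nets.

(** A finite subcover, obtained from the near-covering form of compactness applied to the filter of
    lists ordered by inclusion. *)
Lemma compact_net (T : topologicalType) (U : T -> set T) :
  compact [set: T] -> (forall x, nbhs x (U x)) ->
  exists s : seq T, forall y, exists2 x, x \in s & U x y.
Proof.
move=> /compact_near_coveringP cT nU.
pose F : set_system (seq T) :=
  [set A | exists s0 : seq T, forall s : seq T, {subset s0 <= s} -> A s].
have FF : Filter F.
  split; first by exists [::].
    move=> A B [s0 A0] [s1 B1]; exists (s0 ++ s1) => s ss; split.
      by apply: A0 => x xs; apply: ss; rewrite mem_cat xs.
    by apply: B1 => x xs; apply: ss; rewrite mem_cat xs orbT.
  by move=> A B AB [s0 A0]; exists s0 => s /A0/AB.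
have [|s0 H] := cT _ F (fun (s : seq T) y => exists2 x, x \in s & U x y) FF.
  move=> x _; exists (U x, [set s : seq T | x \in s]) => /=.
    by split; [exact: nU|exists [:: x] => s; apply; rewrite inE].
  by move=> [y s] /= [Uy xs]; exists x.
by exists s0 => y; apply: H.
Qed.

Lemma cvg_zmodD (T : Type) (F : set_system T) (X : topologicalZmodType)
    (f g : T -> X) (a b : X) : Filter F ->
  f @ F --> a -> g @ F --> b -> (fun x => f x + g x) @ F --> a + b.
Proof.
move=> FF fa gb.
exact: (@continuous2_cvg _ _ _ _ F FF f g +%R a b (@add_continuous X (a, b)) fa gb).
Qed.

Lemma cvg_zmodB (T : Type) (F : set_system T) (X : topologicalZmodType)
    (f g : T -> X) (a b : X) : Filter F ->
  f @ F --> a -> g @ F --> b -> (fun x => f x - g x) @ F --> a - b.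
Proof.
move=> FF fa gb.
exact: (@continuous2_cvg _ _ _ _ F FF f g (fun x y => x - y) a b
  (@sub_continuous X (a, b)) fa gb).
Qed.

Lemma nbhs_subl (X : topologicalZmodType) (x : X) (W : set X) :
  nbhs (0 : X) W -> nbhs x [set y | W (y - x)].
Proof.
have : (fun y => y - x) @ x --> x - x by apply: cvg_zmodB; [exact: cvg_id|exact: cvg_cst].
by rewrite subrr; apply.
Qed.

Lemma nbhs_subr (X : topologicalZmodType) (x : X) (W : set X) :
  nbhs (0 : X) W -> nbhs x [set y | W (x - y)].
Proof.
have : (fun y => x - y) @ x --> x - x by apply: cvg_zmodB; [exact: cvg_cst|exact: cvg_id].
by rewrite subrr; apply.
Qed.

Variable R : realType.


(** Near-covering on the compact product makes one [W] work at all points. The extra coordinate [y]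
    serves Fubini and the comparison of a metric with the group structure. *)
Lemma uniform_translation (X : topologicalZmodType) (Y : topologicalType)
    (F : X * Y -> R) (e : R) :
  compact [set: X] -> compact [set: Y] -> continuous F -> 0 < e ->
  exists2 W, nbhs (0 : X) W &
    forall w x y, W w -> `|F (x + w, y) - F (x, y)| <= e.
Proof.
move=> cX cY cF e0.
have /compact_near_coveringP cXY : compact [set: X * Y].
  by rewrite -setXTT; exact: compact_setX.
have := cXY _ (nbhs (0 : X))
  (fun w z => `|F (z.1 + w, z.2) - F (z.1, z.2)| <= e) (nbhs_filter _).
move=> H; have {H} : \forall w \near (0 : X), forall z, `|F (z.1 + w, z.2) - F (z.1, z.2)| <= e.
  suff /H : forall z, [set: X * Y] z -> \forall z' \near z & w \near (0 : X),
      `|F (z'.1 + w, z'.2) - F (z'.1, z'.2)| <= e.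
    by apply: filterS => w Hw z; exact: Hw.
  move=> {H}[x y] _.
  have e20 : 0 < e / 2 by rewrite divr_gt0.
  have c1 : (fun p : (X * Y) * X => F (p.1.1 + p.2, p.1.2)) @
      ((x, y), (0 : X)) --> F (x, y).
    apply: (@continuous_cvg _ _ _ _ _ (fun p : (X * Y) * X => (p.1.1 + p.2, p.1.2)) F).
      exact: cF.
    apply: cvg_pair => /=; last first.
      by apply: cvg_comp; [exact: cvg_fst|exact: cvg_snd].
    have : (fun p : (X * Y) * X => p.1.1 + p.2) @ ((x, y), (0 : X)) --> x + 0.
      apply: cvg_zmodD; last exact: cvg_snd.
      by apply: cvg_comp; [exact: cvg_fst|exact: cvg_fst].
    by rewrite addr0.
  have c2 : (fun p : (X * Y) * X => F p.1) @ ((x, y), (0 : X)) --> F (x, y).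
    by apply: (@continuous_cvg _ _ _ _ _ fst F); [exact: cF|exact: cvg_fst].
  move/cvgrPdist_le : c1 => /(_ _ e20) c1; move/cvgrPdist_le : c2 => /(_ _ e20) c2.
  near=> p.
  rewrite [e]splitr -(subrKA (F (x, y))) (le_trans (ler_normD _ _))// lerD//.
    rewrite distrC; near: p; exact: c1.
  rewrite -surjective_pairing.
  near: p; exact: c2.
move=> WP; exists [set w | forall z, `|F (z.1 + w, z.2) - F (z.1, z.2)| <= e] => //.
by move=> w x y /(_ (x, y)).
Unshelve. all: end_near. Qed.

End compact_nets.

(** * The invariant mean of a continuous function *)

Section mean.
Variables (R : realType) (X : topologicalZmodType).
Hypothesis X_compact : compact [set: X].
Implicit Types f g : X -> R.

Lemma uniform_continuity f (e : R) : continuous f -> 0 < e ->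
  exists2 W, nbhs (0 : X) W & forall w x, W w -> `|f (x + w) - f x| <= e.
Proof.
move=> cf e0; have [|W W0 WP] :=
    @uniform_translation R X X (fun z => f z.1) e X_compact X_compact _ e0.
  by move=> z; apply: (@continuous_cvg _ _ _ _ _ fst f); [exact: cf|exact: cvg_fst].
by exists W => // w x /(WP w x 0).
Qed.

Lemma continuous_bounded f : continuous f -> exists C, forall x, `|f x| <= C.
Proof.
move=> cf; have [|s sP] := compact_net (U := fun x => [set y | `|f x - f y| <= 1]) X_compact.
  by move=> x; have /cvgrPdist_le := cf x; apply.
exists (1 + \sum_(a <- s) `|f a|) => y; have [x xs /= fxy] := sP y.
rewrite -(subrK (f x) (f y)) (le_trans (ler_normD _ _))// lerD 1?distrC//.
by rewrite (big_rem x)//= lerDl sumr_ge0.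
Qed.

Lemma avg_lt (s : seq X) f x b (u m : R) : b \in s -> (forall y, f y <= u) ->
  f (x + b) <= u - m -> avg s f x <= u - m / (size s)%:R.
Proof.
move=> bs fu fb.
have s0 : 0 < (size s)%:R :> R by rewrite ltr0n; case: (s) bs.
rewrite /avg ler_pdivrMr// mulrBl mulfVK ?gt_eqF// mulr_natr -[X in u *+ X]count_predT.
have -> : u *+ count predT s = \sum_(a <- s) u by rewrite big_const_seq iter_addr_0.
by rewrite (big_rem b)//= [X in _ <= X - _](big_rem b)//= addrAC lerD// ler_sum.
Qed.

(* The mean is the infimum of the upper bounds of the averages of [f]: an
   average with an almost optimal upper bound but far from constant would be
   improved by averaging it once more over a net. *)
Lemma mean_exists f : continuous f -> exists c, is_mean f c.
Proof.
move=> cf; have [C fC] := continuous_bounded cf.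
pose A := [set c : R | exists2 s, s != [::] & forall x, avg s f x <= c].
have Alb : has_lbound A.
  exists (- C) => c [s s0 /(_ 0)]; apply: le_trans; rewrite -(avg_cst (- C) 0 s0).
  by apply: ler_avg => y; have := fC y; rewrite ler_norml => /andP[].
have infA : has_inf A.
  split=> //; exists C; exists [:: 0] => // x; rewrite -[leRHS](avg_cst (s := [:: 0]) _ x)//.
  by apply: ler_avg => y; exact: ler_normlW.
exists (inf A) => e e0.
have [W W0 WP] := uniform_continuity cf (divr_gt0 e0 (ltr0Sn R 1)).
have [|t tP] := compact_net (U := fun a => [set z | W (a - z)]) X_compact.
  by move=> a; exact: nbhs_subr.
have t0 : t != [::] by case: t tP => // /(_ 0)[].
have n0 : 0 < (size t)%:R :> R by rewrite ltr0n lt0n size_eq0.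
(* A dip of depth [e] at [y] persists at depth [e / 2] on [y + W], and one more average over the net
   [t] turns it into a gain of [e / 2 / size t] at every point. The slack [eta] is half of that
   gain, which leaves an upper bound strictly below the infimum. *)
pose eta := e / 2 / (size t)%:R / 2.
have eta0 : 0 < eta by rewrite !divr_gt0.
have etaE : e / 2 / (size t)%:R = 2 * eta by rewrite /eta; field; rewrite gt_eqF.
have etae : eta <= e.
  have n1 : 1 <= (size t)%:R :> R by rewrite ler1n lt0n size_eq0.
  have -> : e = 4 * eta * (size t)%:R by rewrite /eta; field; rewrite gt_eqF.
  nra.
have [c [s s0 sc] ceta] := inf_adherent eta0 infA.
exists s => // y; rewrite ler_norml; apply/andP; split; last first.
  by rewrite lerBlDl (le_trans (sc y))// (le_trans (ltW ceta))// lerD2l.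
rewrite leNgt; apply/negP => ylt.
have gW w : W w -> avg s f (y + w) <= inf A - e / 2.
  move=> Ww; rewrite -(subrK (e / 2) (avg s f _)).
  rewrite (_ : inf A - e / 2 = inf A - e + e / 2); last lra.
  rewrite lerD2r; apply: ltW; apply: le_lt_trans (_ : avg s f y < _); last first.
    by lra.
  rewrite lerBlDr (_ : _ + e / 2 = avg s (fun z => f z + e / 2) y); last first.
    by rewrite avgD avg_cst.
  rewrite (_ : avg s f (y + w) = avg s (fun z => f (z + w)) y).
    apply: ler_avg => z; rewrite -lerBlDl.
    exact: ler_normlW (WP _ _ Ww).
  by rewrite /avg; under eq_bigr do rewrite addrAC.
suff /(ge_inf Alb) : A (inf A + eta - (e / 2) / (size t)%:R).
  by rewrite etaE; lra.
exists [seq a + b | a <- t, b <- s]; first by rewrite allpairs_neq0// size_eq0.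
move=> x; rewrite -avg_avg; have [b bt Wb] := tP (y - x).
apply: (avg_lt bt) => [z|]; first by rewrite (le_trans (sc z))// ltW.
rewrite (_ : x + b = y + (b - (y - x))); last by rewrite opprB addrCA [y + _]addrC subrK addrC.
by rewrite (le_trans (gW _ Wb))// lerD2r lerDl ltW.
Qed.

(* Equal to 0 when [f] has no mean. *)
Definition haar f : R := xget 0 [set c | is_mean f c].

Lemma haarP f : continuous f -> is_mean f (haar f).
Proof. by move=> /mean_exists[c fc]; exact: (xgetI 0 fc). Qed.

Lemma haar_eq f c : is_mean f c -> haar f = c.
Proof. by move=> fc; apply: (mean_unique _ fc); exact: (xgetI 0 fc). Qed.

Lemma haar_cst c : haar (fun=> c) = c.
Proof. by apply: haar_eq; exact: mean_cst. Qed.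

Lemma haarD f g : continuous f -> continuous g ->
  haar (fun x => f x + g x) = haar f + haar g.
Proof. by move=> cf cg; apply: haar_eq; apply: meanD; exact: haarP. Qed.

Lemma haarZ k f : continuous f -> haar (fun x => k * f x) = k * haar f.
Proof. by move=> cf; apply: haar_eq; apply: meanZ; exact: haarP. Qed.

Lemma haarB f g : continuous f -> continuous g ->
  haar (fun x => f x - g x) = haar f - haar g.
Proof.
move=> cf cg; rewrite -[haar g]mul1r -mulNr; apply: haar_eq.
apply: (eq_mean (f := fun x => f x + -1 * g x)) => [x|]; first by rewrite mulN1r.
by apply: meanD; [exact: haarP|apply: meanZ; exact: haarP].
Qed.

Lemma haar_translate a f : continuous f -> haar (fun x => f (x + a)) = haar f.
Proof. by move=> cf; apply: haar_eq; apply: mean_translate; exact: haarP. Qed.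

Lemma haar_ge0 f : continuous f -> (forall x, 0 <= f x) -> 0 <= haar f.
Proof. by move=> cf f0; apply: (mean_ge0 f0); exact: haarP. Qed.

Lemma ler_haar f g : continuous f -> continuous g ->
  (forall x, f x <= g x) -> haar f <= haar g.
Proof.
move=> cf cg fg; rewrite -subr_ge0 -haarB//; apply: haar_ge0 => [x|x].
  by apply: cvgB; [exact: cg|exact: cf].
by rewrite subr_ge0.
Qed.

Lemma haar_norm_le f C : continuous f -> (forall x, `|f x| <= C) -> `|haar f| <= C.
Proof.
move=> cf fC; have cC D : continuous (fun _ : X => D : R) by move=> x; exact: cvg_cst.
rewrite ler_norml -{1}(haar_cst (- C)) -{2}(haar_cst C).
by rewrite !ler_haar// => x; have := fC x; rewrite ler_norml => /andP[].
Qed.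

Lemma haar_near f g e : continuous f -> continuous g ->
  (forall x, `|f x - g x| <= e) -> `|haar f - haar g| <= e.
Proof.
move=> cf cg fg; rewrite -haarB//; apply: haar_norm_le => // x.
by apply: cvgB; [exact: cf|exact: cg].
Qed.

(** Finitely many translates of a neighborhood where [f] is at least [f x / 2] cover the group, so
    the average over the net has a positive lower bound, which further averaging keeps. *)
Lemma haar_gt0 f x : continuous f -> (forall y, 0 <= f y) -> 0 < f x -> 0 < haar f.
Proof.
move=> cf f0 fx.
have [W W0 WP] := uniform_continuity cf (divr_gt0 fx (ltr0Sn R 1)).
have [|t tP] := compact_net (U := fun a => [set z | W (a - z)]) X_compact.
  by move=> a; exact: nbhs_subr.
have n0 : 0 < (size t)%:R :> R.
  by rewrite ltr0n lt0n size_eq0; case: t tP => // /(_ 0)[].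
have tf y : f x / 2 / (size t)%:R <= avg t f y.
  rewrite ler_pM2r ?invr_gt0//; have [b bt /= Wb] := tP (x - y).
  rewrite (big_rem b)//=; apply: ler_wpDr; first exact: sumr_ge0.
  have -> : y + b = x + (b - (x - y)) by rewrite opprB addrCA [x + _]addrC subrK addrC.
  have := WP _ x Wb; rewrite ler_norml => /andP[]; lra.
apply: (@lt_le_trans _ _ (f x / 2 / (size t)%:R)); first by rewrite !divr_gt0.
apply/ler_addgt0Pr => e e0.
have [s s0 /(_ t 0)] := mean_refine (haarP cf) e0.
rewrite -size_eq0 -lt0n -(ltr0n R) => /(_ n0); rewrite avgC ler_norml => /andP[_].
rewrite lerBlDl; apply: le_trans.
by rewrite -[leLHS](avg_cst (s := s) _ 0)//; exact: ler_avg.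
Qed.

Lemma continuous_translation f :
  (forall e : R, 0 < e -> exists2 W, nbhs (0 : X) W &
    forall w x, W w -> `|f (x + w) - f x| <= e) -> continuous f.
Proof.
move=> fP x; apply/cvgrPdist_le => e /fP[W W0 WP].
have := nbhs_subl x W0; apply: filterS => y Wy.
by rewrite distrC -{1}(subrKC x y) WP.
Qed.

(** Averaging once more preserves closeness to a constant, so lists found for separate functions
    combine by sums. *)
Lemma haar_uniform (I : eqType) (l : seq I) (g : I -> X -> R) e :
  (forall i, continuous (g i)) -> 0 < e ->
  exists2 t : seq X, t != [::] &
    forall i y, i \in l -> `|avg t (g i) y - haar (g i)| <= e.
Proof.
move=> cg e0; elim: l => [|i l [t t0 IH]]; first by exists [:: 0].
have [s s0 sP] := haarP (cg i) e0.
exists [seq a + b | a <- s, b <- t]; first by rewrite allpairs_neq0// size_eq0.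
move=> j y; rewrite inE -avg_avg => /orP[/eqP ->|jl].
  by rewrite avgC; exact: avg_near.
by apply: avg_near => // z; exact: IH.
Qed.

Lemma mean_swap (F : X * X -> R) c :
  is_mean F c -> is_mean (fun z => F (z.2, z.1)) c.
Proof.
move=> Fc e /Fc[s s0 sc]; exists [seq (z.2, z.1) | z <- s]; first by case: (s) s0.
by move=> [x y]; rewrite /avg big_map size_map; exact: (sc (y, x)).
Qed.

Section joint.
Variable F : X * X -> R.
Hypothesis F_cont : continuous F.

Lemma continuous_partial x : continuous (fun y => F (x, y)).
Proof.
move=> y; apply: (@continuous_cvg _ _ _ _ _ (fun y => (x, y)) F); first exact: F_cont.
by apply: cvg_pair; [exact: cvg_cst|exact: cvg_id].
Qed.

Lemma haar_equicontinuous (e : R) : 0 < e -> exists2 W, nbhs (0 : X) W &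
  forall w x, W w ->
    `|haar (fun y => F (x + w, y)) - haar (fun y => F (x, y))| <= e.
Proof.
move=> e0; have [W W0 WP] := uniform_translation X_compact X_compact F_cont e0.
by exists W => // w x Ww; apply: haar_near => [||y];
  [exact: continuous_partial|exact: continuous_partial|exact: WP].
Qed.

Lemma continuous_haar : continuous (fun x => haar (fun y => F (x, y))).
Proof. exact/continuous_translation/haar_equicontinuous. Qed.

(** Equicontinuity in [x] reduces to the finitely many [x] of a net, for which [haar_uniform] yields
    a common list. *)
Lemma mean_haar : is_mean F (haar (fun x => haar (fun y => F (x, y)))).
Proof.
apply: (mean_iterated (g := fun x => haar (fun y => F (x, y)))) => [e e0|]; last first.
  exact/haarP/continuous_haar.
have e30 : 0 < e / 3 by rewrite divr_gt0.
have [W W0 WP] := uniform_translation X_compact X_compact F_cont e30.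
have [|l lP] := compact_net (U := fun a => [set z | W (z - a)]) X_compact.
  by move=> a; exact: nbhs_subl.
have [t t0 tP] := haar_uniform l continuous_partial e30.
exists t => // x y; have [a al /= Wa] := lP x.
have h1 : `|haar (fun y => F (x, y)) - haar (fun y => F (a, y))| <= e / 3.
  apply: haar_near => [||z]; [exact: continuous_partial|exact: continuous_partial|].
  by rewrite -{1}(subrKC a x) WP.
have h2 : `|avg t (fun y => F (x, y)) y - avg t (fun y => F (a, y)) y| <= e / 3.
  rewrite -[X in `|_ - X|]mul1r -mulNr -avgZ -avgD -[X in `|X|]subr0.
  apply: avg_near => // z; rewrite subr0 mulN1r.
  by rewrite -{1}(subrKC a x) WP.
have := tP a y al; move: h1 h2; rewrite !ler_norml => /andP[? ?] /andP[? ?] /andP[? ?].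
by apply/andP; split; lra.
Qed.

End joint.

(** Both iterated means are means of [F] on the product group, where the mean is unique. *)
Lemma haar_fubini (F : X * X -> R) : continuous F ->
  haar (fun x => haar (fun y => F (x, y))) =
  haar (fun y => haar (fun x => F (x, y))).
Proof.
move=> cF; apply: mean_unique (mean_haar cF) _.
have : continuous (fun z : X * X => F (z.2, z.1)).
  move=> z; apply: (@continuous_cvg _ _ _ _ _ (fun z => (z.2, z.1)) F); first exact: cF.
  by apply: cvg_pair; [exact: cvg_snd|exact: cvg_fst].
move=> /mean_haar/mean_swap; apply: eq_mean => -[x y] //.
Qed.

End mean.

(** * Convolution operators *)

Section scalar_sequence.
Variables (R : realType) (t : nat -> R).
Hypothesis t_gt0 : forall n, 0 < t n.
Hypothesis t_logconvex : forall n, t n.+1 ^+ 2 <= t n * t n.+2.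
Hypothesis t_submul : forall i j, t (i + j).+1 <= t i * t j.

Let ratio n := t n.+1 / t n.

Let ratio_gt0 n : 0 < ratio n. Proof. by rewrite divr_gt0. Qed.

Let ratio_nondecreasing : {homo ratio : n m / (n <= m)%N >-> n <= m}.
Proof.
apply/nondecreasing_seqP => n; rewrite /ratio ler_pdivrMr// mulrAC ler_pdivlMr//.
by rewrite -expr2 mulrC.
Qed.

Let ratio_le n : ratio n <= t 0%N.
Proof. by rewrite /ratio ler_pdivrMr// mulrC -{1}[n]addn0 t_submul. Qed.

Let t_power N m : t (N.+1 * m.+1).-1 <= t N ^+ m.+1.
Proof.
elim: m => [|m IH]; first by rewrite muln1.
rewrite (_ : _.-1 = ((N.+1 * m.+1).-1 + N).+1); last lia.
by rewrite (le_trans (t_submul _ _))// exprSr ler_pM2r.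
Qed.

Let t_geometric n0 n : t n0 * ratio n0 ^+ n <= t (n0 + n)%N.
Proof.
elim: n => [|n IH]; first by rewrite mulr1 addn0.
rewrite exprSr mulrA addnS (le_trans (ler_wpM2r (ltW (ratio_gt0 n0)) IH))//.
by rewrite mulrC -ler_pdivlMr// ratio_nondecreasing// leq_addr.
Qed.

(** [rho] is the supremum of the nondecreasing ratios. If [t n < rho ^+ n.+1], some [ratio N]
    already satisfies [t n < ratio N ^+ n.+1]; along the indices [(n.+1 * m.+1).-1]
    submultiplicativity then makes [t] decay relative to the powers of [ratio N], whereas
    log-convexity makes it grow at least at that rate. The index [n] stands for the exponent [n.+1],
    whence the shifts. *)
Lemma logconvex_rate : exists2 rho, 0 < rho &
  forall n, t n.+1 <= rho * t n /\ rho ^+ n.+1 <= t n.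
Proof.
have supr : has_sup (range ratio).
  by split; [exists (ratio 0%N), 0%N|exists (t 0%N) => _ [n _ <-]].
have rsup n : ratio n <= sup (range ratio) by apply: sup_upper_bound => //; exists n.
exists (sup (range ratio)); first exact: lt_le_trans (ratio_gt0 0) (rsup 0%N).
move=> n; split; first by rewrite -ler_pdivrMr//; exact: rsup.
have rcvg : ratio @ \oo --> sup (range ratio).
  exact: nondecreasing_cvgn ratio_nondecreasing supr.2.
rewrite leNgt; apply/negP => tlt.
have : ratio i ^+ n.+1 @[i --> \oo] --> sup (range ratio) ^+ n.+1.
  by apply: (@continuous_cvg _ _ _ _ _ ratio (fun x => x ^+ n.+1)) rcvg; exact: exprn_continuous.
move=> /cvgr_gt/(_ _ tlt)[N _ /(_ N (leqnn N)) /= tr].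
have r0 : 0 < ratio N ^+ n.+1 by rewrite exprn_gt0.
have u1 : `|t n / ratio N ^+ n.+1| < 1.
  by rewrite gtr0_norm ?divr_gt0// ltr_pdivrMr// mul1r.
have := cvg_expr u1 => /cvgr_lt/(_ (t N / ratio N ^+ N.+1)).
rewrite divr_gt0// ?exprn_gt0// => /(_ isT)[m0 _ /(_ (m0 + N).+1)].
have /= -> : (m0 <= (m0 + N).+1)%N by lia.
move=> /(_ isT); apply/negP; rewrite -leNgt.
have geo := t_geometric N (n.+1 * (m0 + N).+1 - N.+1).
move: r0 geo; have : 0 < ratio N by []; move: (ratio N) => q q0 r0 geo.
rewrite expr_div_n ler_pdivlMr ?exprn_gt0// (le_trans _ (t_power _ _))//.
rewrite (_ : _.-1 = N + (n.+1 * (m0 + N).+1 - N.+1))%N; last nia.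
apply: le_trans geo.
rewrite -mulrA ler_pM2l// -exprM mulrC.
rewrite -{1}(@subnK N.+1 (n.+1 * (m0 + N).+1)); last nia.
by rewrite exprD mulfK// expf_neq0// gt_eqF.
Qed.

End scalar_sequence.

Section real_functions.
Variables (R : realType) (T : topologicalType).
Implicit Types f g : T -> R.

Lemma ctsM f g : continuous f -> continuous g -> continuous (fun x => f x * g x).
Proof. by move=> cf cg x; apply: cvgM; [exact: cf|exact: cg]. Qed.

Lemma ctsD f g : continuous f -> continuous g -> continuous (fun x => f x + g x).
Proof. by move=> cf cg x; apply: cvgD; [exact: cf|exact: cg]. Qed.

Lemma ctsB f g : continuous f -> continuous g -> continuous (fun x => f x - g x).
Proof. by move=> cf cg x; apply: cvgB; [exact: cf|exact: cg]. Qed.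

Lemma ctsZ (c : R) f : continuous f -> continuous (fun x => c * f x).
Proof. by move=> cf; apply: ctsM => // x; exact: cvg_cst. Qed.

Lemma cts_comp (S U : topologicalType) (h : S -> U) (f : U -> R) :
  continuous h -> continuous f -> continuous (fun x => f (h x)).
Proof. by move=> ch cf x; apply: (@continuous_cvg _ _ _ _ _ h f); [exact: cf|exact: ch]. Qed.

End real_functions.

Section group_maps.
Variable X : topologicalZmodType.

Lemma cts_addr (a : X) : continuous (fun x => x + a).
Proof. by move=> x; apply: cvg_zmodD; [exact: cvg_id|exact: cvg_cst]. Qed.

Lemma cts_opp : continuous (fun x : X => - x).
Proof.
move=> x; have : (fun y : X => 0 - y) @ x --> 0 - x.
  by apply: cvg_zmodB; [exact: cvg_cst|exact: cvg_id].
by rewrite sub0r; under eq_fun do rewrite sub0r.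
Qed.

Lemma cts_sub : continuous (fun z : X * X => z.1 - z.2).
Proof. exact: sub_continuous. Qed.

Lemma cts_fst (S T : topologicalType) : continuous (@fst S T).
Proof. by move=> x; exact: cvg_fst. Qed.

Lemma cts_snd (S T : topologicalType) : continuous (@snd S T).
Proof. by move=> x; exact: cvg_snd. Qed.

End group_maps.

Section uniform_limits.
Variables (R : realType) (T : topologicalType).

Lemma uniform_limit (u : nat -> T -> R) :
  (forall n, continuous (u n)) ->
  (forall e, 0 < e -> exists N, forall n m x, (N <= n)%N -> (N <= m)%N ->
     `|u n x - u m x| <= e) ->
  exists2 g : T -> R, continuous g &
    forall e, 0 < e -> exists N, forall n x, (N <= n)%N -> `|u n x - g x| <= e.
Proof.
move=> cu uC.
have cvu x : cvgn (fun n => u n x).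
  apply/cauchy_cvgP/cauchy_exP => e e0.
  have [N NP] := uC (e / 2) (divr_gt0 e0 (ltr0Sn R 1)).
  exists (u N x); exists N => // n /= Nn; rewrite /ball/=.
  by apply: le_lt_trans (NP _ _ x _ Nn) _ => //; lra.
have lim_near e : 0 < e -> exists N, forall n x, (N <= n)%N ->
    `|u n x - limn (fun n => u n x)| <= e.
  move=> e0; have [N NP] := uC e e0; exists N => n x Nn.
  have : `|u n x - u m x| @[m --> \oo] --> `|u n x - limn (fun n => u n x)|.
    by apply: cvg_norm; apply: cvgB; [exact: cvg_cst|exact: cvu].
  move=> h; rewrite -(cvg_lim _ h)//; apply: limr_le; first by apply/cvg_ex; eexists; exact: h.
  by exists N => // m /= Nm; exact: NP.
exists (fun x => limn (fun n => u n x)) => // x.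
apply/cvgrPdist_le => e e0; have e30 : 0 < e / 3 by rewrite divr_gt0.
have [N NP] := lim_near _ e30.
have /cvgrPdist_le/(_ _ e30) := cu N x; apply: filterS => y uxy.
have := NP N y (leqnn N); have := NP N x (leqnn N); move: uxy.
rewrite !ler_norml => /andP[? ?] /andP[? ?] /andP[? ?].
by apply/andP; split; lra.
Qed.

End uniform_limits.

(** * Inner product and convolution by a continuous kernel *)

Section convolution.
Variables (R : realType) (X : topologicalZmodType).
Hypothesis X_compact : compact [set: X].
Implicit Types f g : X -> R.

Definition dot f g := haar (fun x => f x * g x).

Definition conv k f x : R := haar (fun y => k (x - y) * f y).

Lemma dotC f g : dot f g = dot g f.
Proof. by rewrite /dot; under eq_fun do rewrite mulrC. Qed.

Lemma dotDl f f' g : continuous f -> continuous f' -> continuous g ->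
  dot (fun x => f x + f' x) g = dot f g + dot f' g.
Proof.
move=> cf cf' cg; rewrite /dot -haarD//; try exact: ctsM.
by under eq_fun do rewrite mulrDl.
Qed.

Lemma dotZl c f g : continuous f -> continuous g ->
  dot (fun x => c * f x) g = c * dot f g.
Proof.
move=> cf cg; rewrite /dot -haarZ//; last exact: ctsM.
by under eq_fun do rewrite -mulrA.
Qed.

Lemma dot_ge0 f : continuous f -> 0 <= dot f f.
Proof. by move=> cf; apply: haar_ge0 => // [|x]; [exact: ctsM|rewrite -expr2 sqr_ge0]. Qed.

Lemma dot_gt0 f x : continuous f -> f x != 0 -> 0 < dot f f.
Proof.
move=> cf fx; apply: (@haar_gt0 _ _ X_compact _ x) => // [|y|].
- exact: ctsM.
- by rewrite -expr2 sqr_ge0.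
- by rewrite -expr2 exprn_even_gt0.
Qed.

Lemma dot_comb a b f g : continuous f -> continuous g ->
  dot (fun x => a * f x + b * g x) (fun x => a * f x + b * g x) =
  a ^+ 2 * dot f f + 2 * a * b * dot f g + b ^+ 2 * dot g g.
Proof.
move=> cf cg; have caf := ctsZ (c := a) cf; have cbg := ctsZ (c := b) cg.
have cc := ctsD caf cbg.
rewrite dotDl// !dotZl// (dotC f) (dotC g) !dotDl// !dotZl// (dotC g f); ring.
Qed.

Lemma dot_cauchy_schwarz f g : continuous f -> continuous g ->
  dot f g ^+ 2 <= dot f f * dot g g.
Proof.
move=> cf cg; have [g0|/asboolPn] := pselect (forall x, g x = 0).
  rewrite (_ : g = fun=> 0); last exact/funext.
  rewrite /dot; under eq_fun do rewrite mulr0.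
  by rewrite haar_cst expr0n mulr_ge0// ?haar_cst// dot_ge0.
move=> /existsp_asboolPn[x /eqP gx]; have gg := dot_gt0 cg gx.
(* The function is [dot g g] times the component of [f] orthogonal to [g]. *)
have := dot_ge0 (ctsD (ctsZ (c := dot g g) cf) (ctsZ (c := - dot f g) cg)).
rewrite dot_comb// => h.
have {}h : 0 <= dot g g * (dot f f * dot g g - dot f g ^+ 2).
  by apply: le_trans h _; rewrite le_eqVlt; apply/orP; left; apply/eqP; ring.
by rewrite pmulr_rge0// subr_ge0 in h.
Qed.

Section kernel.
Variable k : X -> R.
Hypothesis k_cont : continuous k.
Local Notation T := (conv k).

Lemma conv_kernel_cts f : continuous f ->
  continuous (fun z : X * X => k (z.1 - z.2) * f z.2).
Proof.
move=> cf; apply: ctsM; apply: cts_comp => //; [exact: cts_sub|exact: cts_snd].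
Qed.

Lemma conv_integrand_cts f x : continuous f -> continuous (fun y => k (x - y) * f y).
Proof. by move=> cf; exact: (continuous_partial (conv_kernel_cts cf)). Qed.

Lemma conv_cts f : continuous f -> continuous (T f).
Proof. by move=> cf; exact: (continuous_haar X_compact (conv_kernel_cts cf)). Qed.

Lemma iter_conv_cts n f : continuous f -> continuous (iter n T f).
Proof. by move=> cf; elim: n => //= n; exact: conv_cts. Qed.

Lemma conv_translate a f : continuous f -> T (fun y => f (y + a)) = fun x => T f (x + a).
Proof.
move=> cf; apply/funext => x; rewrite /conv.
rewrite -(haar_translate X_compact a (f := fun y => k (x + a - y) * f y)); last first.
  exact: (conv_integrand_cts cf).
congr haar; apply/funext => y; congr (k _ * _).
by rewrite opprD [- y - a]addrC addrA addrK.
Qed.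

Lemma iter_conv_translate n a f : continuous f ->
  iter n T (fun y => f (y + a)) = fun x => iter n T f (x + a).
Proof.
by move=> cf; elim: n => //= n ->; rewrite conv_translate//; exact: iter_conv_cts.
Qed.

Lemma conv_near f g e K : continuous f -> continuous g ->
  (forall x, `|k x| <= K) -> (forall x, `|f x - g x| <= e) ->
  forall x, `|T f x - T g x| <= K * e.
Proof.
move=> cf cg kK fg x; apply: haar_near => // [||y].
- exact: (conv_integrand_cts cf).
- exact: (conv_integrand_cts cg).
by rewrite -mulrBr normrM ler_pM.
Qed.

Lemma convZ c f : continuous f -> T (fun x => c * f x) = fun x => c * T f x.
Proof.
move=> cf; apply/funext => x; rewrite /conv -haarZ//; last first.
  exact: (conv_integrand_cts cf).
by under eq_fun do rewrite mulrCA.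
Qed.

Lemma convD f g : continuous f -> continuous g ->
  T (fun x => f x + g x) = fun x => T f x + T g x.
Proof.
move=> cf cg; apply/funext => x; rewrite /conv -haarD//; last 2 first.
- exact: (conv_integrand_cts cf).
- exact: (conv_integrand_cts cg).
by under eq_fun do rewrite mulrDr.
Qed.

Hypothesis k_even : forall x, k (- x) = k x.

Lemma convE f x : T f x = dot (fun y => k (y + - x)) f.
Proof. by congr haar; apply/funext => y; rewrite -k_even opprB. Qed.

Lemma dot_translate a f g : continuous f -> continuous g ->
  dot (fun y => f (y + a)) (fun y => g (y + a)) = dot f g.
Proof.
by move=> cf cg; apply: (haar_translate X_compact a (f := fun y => f y * g y)); exact: ctsM.
Qed.

(** The passage from quadratic to uniform norms: by evenness [T f x] is the inner product of [f]
    with a translate of [k]. *)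
Lemma conv_sup f x : continuous f -> T f x ^+ 2 <= dot k k * dot f f.
Proof.
move=> cf; have ck : continuous (fun y => k (y + - x)).
  by apply: cts_comp => //; exact: cts_addr.
by rewrite convE -(dot_translate (- x) k_cont k_cont) dot_cauchy_schwarz.
Qed.

Lemma conv_selfadjoint f g : continuous f -> continuous g ->
  dot (T f) g = dot f (T g).
Proof.
move=> cf cg; pose F (z : X * X) := g z.1 * (k (z.1 - z.2) * f z.2).
have cF : continuous F.
  apply: ctsM; last exact: conv_kernel_cts.
  by apply: cts_comp => //; exact: cts_fst.
transitivity (haar (fun x => haar (fun y => F (x, y)))).
  congr haar; apply/funext => x; rewrite mulrC -haarZ//.
  exact: (conv_integrand_cts cf).
rewrite haar_fubini//; congr haar; apply/funext => y.
rewrite /conv -haarZ//; last exact: (conv_integrand_cts cg).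
by congr haar; apply/funext => x; rewrite /F/= -k_even opprB; ring.
Qed.

Lemma iter_conv_selfadjoint n f g : continuous f -> continuous g ->
  dot (iter n T f) g = dot f (iter n T g).
Proof.
move=> cf cg; elim: n g cg => //= n IH g cg.
rewrite conv_selfadjoint//; last exact: iter_conv_cts.
by rewrite IH; [rewrite -iterSr|exact: conv_cts].
Qed.

End kernel.
End convolution.

(** * An eigenfunction by power iteration *)

Section eigenvector.
Variables (R : realType) (X : topologicalZmodType).
Hypothesis X_compact : compact [set: X].
Variables (k : X -> R) (x0 : X).
Hypothesis k_cont : continuous k.
Hypothesis k_even : forall x, k (- x) = k x.
Hypothesis k_neq0 : k x0 != 0.

Local Notation T := (conv k).
(* [p n] is the convolution power of [k] of order [n.+1], whence the shifts of
   indices below. *)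
Let p n : X -> R := iter n T k.
Let m n := dot k (p n).
Let t n := m (n + n).

Let p_cts n : continuous (p n). Proof. exact: iter_conv_cts. Qed.

Let dot_p i j : dot (p i) (p j) = m (i + j).
Proof. by rewrite /p iter_conv_selfadjoint -?iterD//; exact: p_cts. Qed.

Let p0 n : p n.+1 0 = m n.
Proof. by rewrite /p/= convE//; congr dot; apply/funext => y; rewrite oppr0 addr0. Qed.

(** By self-adjointness the left side squares the inner product of a translate of [p i] with [p j].
    At [x = 0] this bound gives log-convexity of [t]; its mean over [x] gives
    submultiplicativity. *)
Let p_le i j x : p (i + j).+1 x ^+ 2 <= t i * t j.
Proof.
rewrite /p/= iterD convE// -iter_conv_selfadjoint//; last 2 first.
- by apply: cts_comp => //; exact: cts_addr.
- exact: p_cts.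
rewrite iter_conv_translate//.
have cpi : continuous (fun y => p i (y + - x)) by apply: cts_comp => //; exact: cts_addr.
have /le_trans := dot_cauchy_schwarz X_compact cpi (@p_cts j); apply.
by rewrite dot_translate// !dot_p.
Qed.

Let t_logconvex n : t n.+1 ^+ 2 <= t n * t n.+2.
Proof. by have := p_le n n.+2 0; rewrite p0 /t addnS -addSn. Qed.

Let t_gt0 n : 0 < t n.
Proof.
have t0 : 0 < t 0 by rewrite /t/= (dot_gt0 X_compact k_cont k_neq0).
(* Log-convexity needs two consecutive positive terms to produce the next one. *)
suff /(_ n)[] : forall n, 0 < t n /\ 0 < t n.+1 by [].
elim => [|{}n [tn tn1]]; split => //.
  rewrite /t -dot_p (dot_gt0 (x := 0) X_compact)// p0.
  by rewrite gt_eqF.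
by have := lt_le_trans (exprn_gt0 2 tn1) (t_logconvex n); rewrite pmulr_rgt0.
Qed.

Let t_submul i j : t (i + j).+1 <= t i * t j.
Proof.
have tt0 : 0 <= t i * t j by rewrite mulr_ge0// ltW.
have -> : t (i + j).+1 = haar (fun x => p (i + j).+1 x ^+ 2) by rewrite /t -dot_p.
rewrite -[leRHS](haar_cst X); apply: ler_haar => //.
- exact: ctsM.
- by move=> x; exact: cvg_cst.
Qed.

Lemma conv_eigenvector : exists2 rho, 0 < rho &
  exists2 g : X -> R, continuous g & g 0 != 0 /\ T (T g) = fun x => rho * g x.
Proof.
have [rho rho0 rhoP] := logconvex_rate t_gt0 t_logconvex t_submul.
exists rho => //.
(* By the choice of [rho], [b] is nonincreasing and at least 1: its convergence will make the
   sequence [u] Cauchy, its lower bound will keep the limit nonzero. *)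
pose b n := t n / rho ^+ n.+1.
have rhoX n : 0 < rho ^+ n by rewrite exprn_gt0.
have b1 n : 1 <= b n by rewrite /b ler_pdivlMr// mul1r (rhoP n).2.
have bD n : b n.+1 <= b n.
  rewrite /b ler_pdivrMr// [rho ^+ n.+2]exprSr mulrA mulfVK ?gt_eqF// mulrC.
  exact: (rhoP n).1.
have bcvg : cvgn b.
  apply: nonincreasing_is_cvgn; first exact/nonincreasing_seqP.
  by exists 1 => _ [n _ <-].
pose u n x := p (n + n).+1 x / rho ^+ n.+1.
have u_cts n : continuous (u n).
  by rewrite /u; under eq_fun do rewrite mulrC; exact: ctsZ.
(* The normalised odd powers, which [T] sends to [rho * u n]; their inner products depend only on
   the sum of the indices, through [b]. *)
pose q n x := (rho ^+ n)^-1 * p (n + n) x.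
have q_cts n : continuous (q n) by exact: ctsZ.
have uq n x : rho * u n x = T (q n) x.
  rewrite convZ// /u -[p _.+1 x]/(T (p (n + n)) x) exprS; field.
  by rewrite !gt_eqF.
have dotq i j : dot (q i) (q j) = rho * b (i + j).
  rewrite /q dotZl//; last exact: ctsZ.
  rewrite dotC dotZl// dotC dot_p /b /t addnACA exprS exprD; field.
  by rewrite !gt_eqF.
have uu i j x : (rho * (u i x - u j x)) ^+ 2 <=
    t 0 * (rho * (b (i + i) - 2 * b (i + j) + b (j + j))).
  rewrite mulrBr !uq (_ : _ - _ = T (fun y => 1 * q i y + -1 * q j y) x); last first.
    by rewrite convD ?convZ ?mulN1r ?mul1r//; exact: ctsZ.
  have cd := ctsD (ctsZ (c := 1) (@q_cts i)) (ctsZ (c := -1) (@q_cts j)).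
  have /le_trans := conv_sup X_compact k_cont k_even x cd; apply.
  rewrite dot_comb// !dotq -[dot k k]/(t 0) le_eqVlt; apply/orP; left; apply/eqP; ring.
have [K kK] := continuous_bounded X_compact k_cont.
have K0 : 0 <= K by exact: le_trans (kK 0).
have [|g g_cts gP] := uniform_limit u_cts.
  (* Past [N] the combination [b (i + i) - 2 * b (i + j) + b (j + j)] is at most [2 * d]; [d] is the
     value for which [uu] then yields [e]. *)
  move=> e e0; pose d := rho * e ^+ 2 / (2 * t 0).
  have d0 : 0 < d by rewrite !(divr_gt0, mulr_gt0, exprn_gt0).
  have /cvgrPdist_le/(_ _ d0)[N _ NP] := bcvg.
  have bN n : (N <= n)%N -> limn b <= b n <= limn b + d.
    move=> Nn; apply/andP; split.
      by apply: nonincreasing_cvgn_ge => //; exact/nonincreasing_seqP.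
    by have := NP n Nn; rewrite /= ler_norml => /andP[? ?]; lra.
  exists N => i j x Ni Nj; rewrite -ler_sqr ?nnegrE ?(ltW e0)//.
  rewrite real_normK ?num_real//.
  rewrite -(ler_pM2l (exprn_gt0 2 rho0)) -exprMn (le_trans (uu i j x))//.
  have -> : rho ^+ 2 * e ^+ 2 = t 0 * (rho * (2 * d)).
    by rewrite /d; field; rewrite gt_eqF.
  rewrite !ler_pM2l//.
  have /andP[? ?] := bN _ (leq_trans Ni (leq_addr i i)).
  have /andP[? ?] := bN _ (leq_trans Ni (leq_addr j i)).
  have /andP[? ?] := bN _ (leq_trans Nj (leq_addr j j)).
  lra.
exists g => //; split.
  (* [u N 0] is [b N], hence at least 1, so accuracy 1/2 suffices. *)
  have [N /(_ N 0 (leqnn N))] := gP (1 / 2) ltac:(lra).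
  rewrite /u p0 -/(t N) -/(b N) ler_norml => /andP[? ?]; have := b1 N => ?.
  by rewrite gt_eqF//; lra.
apply/funext => x; apply/eqP; rewrite -subr_eq0 -normr_le0; apply/ler_addgt0Pr => e e0.
rewrite add0r; have D0 : 0 < K * K + rho by rewrite ltr_wpDl// mulr_ge0.
have [N NP] := gP (e / (K * K + rho)) (divr_gt0 e0 D0).
have TTu : T (T (u N)) = fun x => rho * u N.+1 x.
  rewrite /u (_ : (fun x => _ / _) = fun x => (rho ^+ N.+1)^-1 * p (N + N).+1 x); last first.
    by apply/funext => y; rewrite mulrC.
  rewrite !convZ//; last exact: conv_cts.
  apply/funext => y; rewrite addSn addnS -[p _.+3 y]/(T (T (p (N + N).+1)) y) [rho ^+ N.+2]exprS; field.
  by rewrite !gt_eqF.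
have := conv_near X_compact k_cont (conv_cts X_compact k_cont (u_cts N))
  (conv_cts X_compact k_cont g_cts) kK
  (conv_near X_compact k_cont (u_cts N) g_cts kK (NP N ^~ (leqnn N))) x.
rewrite TTu => h1; have := NP N.+1 x (leqnSn N) => h2.
have -> : T (T g) x - rho * g x =
    rho * (u N.+1 x - g x) - (rho * u N.+1 x - T (T g) x) by ring.
rewrite (le_trans (ler_normB _ _))// normrM (gtr0_norm rho0).
have -> : e = rho * (e / (K * K + rho)) + K * (K * (e / (K * K + rho))).
  by field; rewrite gt_eqF.
by rewrite lerD// ler_pM2l.
Qed.

End eigenvector.

(** * Finite-dimensional invariant spaces *)

Section commuting_family.
Variables (C : numClosedFieldType) (n : nat) (I : eqType) (A : I -> 'M[C]_n).

Let span (l : seq I) := (\sum_(i <- l) <<mxvec (A i)>>)%MS.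

Let span_stable (l : seq I) (v : 'rV[C]_n) (M : 'M[C]_n) :
  (forall i, i \in l -> stablemx v (A i)) -> (mxvec M <= span l)%MS -> stablemx v M.
Proof.
elim: l M => [|i l IH] M vl.
  by rewrite /span big_nil submx0 mxvec_eq0 => /eqP ->; exact: stablemx0.
rewrite /span big_cons => /sub_addsmxP[[u w] /= Mu].
have -> : M = vec_mx (u *m <<mxvec (A i)>>%MS) + vec_mx (w *m span l).
  by apply: (can_inj mxvecK); rewrite Mu linearD/= !vec_mxK.
apply: stablemxD; last first.
  apply: IH => [j jl|]; first by apply: vl; rewrite inE jl orbT.
  by rewrite vec_mxK submxMl.
have /sub_rVP[c ->] : (u *m <<mxvec (A i)>>%MS <= mxvec (A i))%MS.
  by rewrite (submx_trans (submxMl _ _))// genmxE.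
by rewrite linearZ/= mxvecK -scalemxAr scalemx_sub// vl// inE eqxx.
Qed.

(* Finitely many members of the family span all of it, so the finite case applies. *)
Lemma common_eigenvector_family : (0 < n)%N ->
  (forall i j, comm_mx (A i) (A j)) ->
  exists2 v : 'rV[C]_n, v != 0 & forall i, stablemx v (A i).
Proof.
move=> n0 cA.
pose P r := `[< exists l, \rank (span l) = r >].
have [|r rP|r /asboolP[l lr] rmax] := @ex_maxnP P (n * n).
- by exists (\rank (span [::])); apply/asboolP; exists [::].
- by have /asboolP[l <-] := rP; exact: rank_leq_col.
have [|v v0 /allP vl] := @common_eigenvector C n [seq A i | i <- l] n0.
  by move=> _ _ /mapP[i _ ->] /mapP[j _ ->]; exact: cA.
exists v => // i; apply: (span_stable (l := l)) => [j jl|]; first exact/vl/map_f.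
have sub : (span l <= span (i :: l))%MS by rewrite /span big_cons addsmxSr.
have : (span (i :: l) <= span l)%MS.
  rewrite -(geq_leqif (mxrank_leqif_sup sub)) lr; apply: rmax.
  by apply/asboolP; exists (i :: l).
by apply: submx_trans; rewrite /span big_cons (submx_trans _ (addsmxSl _ _))// genmxE.
Qed.

End commuting_family.

Section finite_dimensional_functions.
Variables (R : realType) (X : zmodType) (V : set (X -> R)) (s : seq X).
Hypothesis V_comb : forall a b f g, V f -> V g -> V (fun x => a * f x + b * g x).
Hypothesis V_translate : forall a f, V f -> V (fun x => f (x + a)).
Hypothesis V_eval : forall f, V f -> (forall x, x \in s -> f x = 0) -> forall x, f x = 0.

Let ev (f : X -> R) : 'rV[R]_(size s) := \row_j f s`_j.

Lemma invariant_space_sum n (c : 'I_n -> R) (F : 'I_n -> X -> R) : (exists f, V f) ->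
  (forall i, V (F i)) -> V (fun x => \sum_i c i * F i x).
Proof.
move=> [f Vf]; elim: n c F => [|n IH] c F VF.
  under eq_fun do rewrite big_ord0.
  by have := V_comb 0 0 Vf Vf; under eq_fun do rewrite !mul0r addr0.
under eq_fun do rewrite big_ord_recl.
have := V_comb (c ord0) 1 (VF ord0) (IH (fun i => c (lift ord0 i)) _ (fun i => VF (lift ord0 i))).
by under eq_fun do rewrite mul1r.
Qed.

(** Evaluation on [s] embeds [V] in a space of dimension [size s], so families with free evaluation
    rows have bounded length. One of maximal length generates, since a function outside its span
    could be added to it. It is nonempty because of [f0]. *)
Lemma invariant_space_basis (f0 : X -> R) x0 : V f0 -> f0 x0 != 0 ->
  exists n (F : 'I_n.+1 -> X -> R),
  [/\ forall i, V (F i),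
      forall c : 'I_n.+1 -> R, (forall x, \sum_i c i * F i x = 0) -> c =1 fun=> 0 &
      forall f, V f -> exists c : 'I_n.+1 -> R, forall x, f x = \sum_i c i * F i x].
Proof.
move=> Vf0 f0x0.
pose B n (F : 'I_n -> X -> R) := \matrix_i ev (F i).
pose P n := `[< exists2 F : 'I_n -> X -> R, forall i, V (F i) & row_free (B n F) >].
have P0 : exists n, P n.
  exists 0%N; apply/asboolP; exists (fun _ => f0); first by case.
  by rewrite /row_free flatmx0 mxrank0.
have [|n /asboolP[F VF freeF] nmax] := ex_maxnP P0 (m := size s).
  by move=> n /asboolP[F _ /eqP <-]; exact: rank_leq_col.
have comb_ev k (c : 'I_k -> R) (G : 'I_k -> X -> R) :
    ev (fun x => \sum_i c i * G i x) = (\row_i c i) *m B k G.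
  by apply/rowP => j; rewrite !mxE; apply: eq_bigr => i _; rewrite !mxE.
have V_ex : exists f, V f by exists f0.
have ev_inj f g : V f -> V g -> ev f = ev g -> f =1 g.
  move=> Vf Vg fg x; apply/eqP; rewrite -subr_eq0; apply/eqP.
  rewrite -[f x]mul1r -mulN1r; apply: (V_eval (V_comb 1 (-1) Vf Vg)) => y /(nthP 0)[j js <-].
  by have /rowP/(_ (Ordinal js)) := fg; rewrite !mxE mul1r mulN1r => ->; rewrite subrr.
have genF f : V f -> exists c : 'I_n -> R, forall x, f x = \sum_i c i * F i x.
  move=> Vf; have [/submxP[c fc]|nfB] := boolP (ev f <= B n F)%MS.
    exists (fun i => c 0 i); apply: ev_inj => //; first exact: invariant_space_sum.
    by rewrite comb_ev fc; congr (_ *m _); apply/rowP => i; rewrite mxE.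
  pose G (i : 'I_(1 + n)) := match fintype.split i with inl _ => f | inr j => F j end.
  have BG : B (1 + n)%N G = col_mx (ev f) (B n F).
    apply/matrixP => i j; rewrite !mxE /G; case: fintype.split => k; rewrite !mxE//.
  suff : (n.+1 <= n)%N by rewrite ltnn.
  apply: nmax; apply/asboolP; exists G.
    by move=> i; rewrite /G; case: fintype.split.
  rewrite /row_free BG eqn_leq rank_leq_row/= -(addsmxE (ev f) (B n F)).1.
  apply: (@leq_ltn_trans (\rank (B n F))); first by rewrite (eqP freeF).
  rewrite ltn_neqAle; apply/andP; split; last first.
    by apply: mxrankS; exact: addsmxSr.
  have := mxrank_leqif_sup (addsmxSr (ev f) (B n F)) => -[_ ->].
  by apply: contra nfB; apply: submx_trans; exact: addsmxSl.
case: n F VF freeF genF {nmax} => [|n] F VF freeF genF.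
  by have [c] := genF _ Vf0 => /(_ x0); rewrite big_ord0 => /eqP; rewrite (negPf f0x0).
exists n, F; split => // c c0 i.
have /eqP : (\row_i c i) *m B n.+1 F = 0.
  by rewrite -comb_ev; apply/rowP => j; rewrite !mxE c0.
by rewrite mulmx_free_eq0// => /eqP/rowP/(_ i); rewrite !mxE.
Qed.

(** The common eigenvector [v] exists over the complex numbers, and [chi] is the combination of the
    basis with coefficients [v]; only its real and imaginary parts lie in the real space [V]. It is
    nonzero because the basis is independent over the reals and [v] has a nonzero real or imaginary
    part. *)
Lemma invariant_space_character (f0 : X -> R) x0 : V f0 -> f0 x0 != 0 ->
  exists chi : X -> R[i],
  [/\ V (fun x => complex.Re (chi x)), V (fun x => complex.Im (chi x)),
      exists x, chi x != 0 & exists mu : X -> R[i], forall x a, chi (x + a) = mu a * chi x].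
Proof.
move=> Vf0 f0x0; have [n [F [VF freeF genF]]] := invariant_space_basis Vf0 f0x0.
have /choice[A AP] a : exists A : 'M[R]_n.+1, forall x i, F i (x + a) = \sum_j A i j * F j x.
  have /choice[c cP] i := genF _ (V_translate a (VF i)).
  by exists (\matrix_(i, j) c i j) => x i; rewrite cP; apply: eq_bigr => j _; rewrite mxE.
have AM a b : A (a + b) = A b *m A a.
  apply/matrixP => i j; apply/eqP; rewrite -subr_eq0; apply/eqP.
  have := freeF (fun j => A (a + b) i j - (A b *m A a) i j) _ j; apply => x.
  under eq_bigr do rewrite mulrBl.
  rewrite sumrB -AP addrA AP; apply/eqP; rewrite subr_eq0; apply/eqP.
  under eq_bigr => l _ do rewrite AP mulr_sumr.
  rewrite exchange_big/=; apply: eq_bigr => k _; rewrite !mxE mulr_suml.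
  by apply: eq_bigr => l _; rewrite mulrA.
pose c : {rmorphism R -> R[i]} := real_complex R.
have [||v v0 vA] := @common_eigenvector_family R[i] n.+1 X (fun a => map_mx c (A a)).
- by [].
- by move=> a b; rewrite /comm_mx -!map_mxM -!AM addrC.
have /choice[mu muP] a : exists mu, v *m map_mx c (A a) = mu *: v by apply/sub_rVP.
pose chi x : R[i] := \sum_i v 0 i * c (F i x).
have chiE x : chi x = Complex (\sum_i complex.Re (v 0 i) * F i x) (\sum_i complex.Im (v 0 i) * F i x).
  rewrite /chi; elim/big_ind3 : _ => //= [_ a1 a2 _ b1 b2 -> ->//|i _].
  by case: (v 0 i) => r1 r2; rewrite /c /=; simpc.
exists chi; split.
- under eq_fun do rewrite chiE/=; apply: invariant_space_sum => //; by exists f0.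
- under eq_fun do rewrite chiE/=; apply: invariant_space_sum => //; by exists f0.
- apply/not_existsP => chi0; move/negP: v0; apply; apply/eqP/rowP => i.
  have h x : chi x = 0 by have := chi0 x; move/negP; rewrite negbK => /eqP.
  have h1 := freeF (fun i => complex.Re (v 0 i)) _ i.
  have h2 := freeF (fun i => complex.Im (v 0 i)) _ i.
  rewrite mxE; apply/eqP; rewrite eq_complex/= h1 ?h2 ?eqxx// => x.
    by have := h x; rewrite chiE => /(congr1 (@complex.Im R)).
  by have := h x; rewrite chiE => /(congr1 (@complex.Re R)).
exists mu => x a; rewrite /chi mulr_sumr.
transitivity (\sum_j (v *m map_mx c (A a)) 0 j * c (F j x)).
  under eq_bigr => i _ do rewrite AP rmorph_sum mulr_sumr.
  rewrite exchange_big/=; apply: eq_bigr => j _; rewrite !mxE mulr_suml.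
  by apply: eq_bigr => i _; rewrite mxE rmorphM mulrA.
by rewrite muP; apply: eq_bigr => j _; rewrite mxE mulrA.
Qed.

End finite_dimensional_functions.

(** * Characters of compact groups *)

Section complex_continuity.
Variables (R : realType) (T : topologicalType).
Implicit Types f : T -> R[i].
Local Notation Re := complex.Re.
Local Notation Im := complex.Im.

Lemma normc_bounds (z : R[i]) (e : R) : 0 < e ->
  (`|z| < e%:C%C -> `|Re z| < e /\ `|Im z| < e) /\
  (`|Re z| < e / 2 -> `|Im z| < e / 2 -> `|z| < e%:C%C).
Proof.
move=> e0; rewrite normc_def ltcR; split=> [ze|rz iz].
  have sqr_lt : (Re z) ^+ 2 + (Im z) ^+ 2 < e ^+ 2.
    by rewrite -(ltr_sqrt _ (exprn_gt0 2 e0)) sqrtr_sqr (gtr0_norm e0).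
  by split; rewrite -ltr_sqr ?nnegrE ?(ltW e0)// real_normK ?num_real//;
    apply: le_lt_trans sqr_lt; rewrite ?lerDl ?lerDr sqr_ge0.
rewrite -[ltRHS](gtr0_norm e0) -sqrtr_sqr ltr_sqrt ?exprn_gt0//.
have q x : `|x| < e / 2 -> x ^+ 2 < (e / 2) ^+ 2.
  move=> xe; rewrite -real_normK ?num_real// ltr_sqr ?nnegrE//.
  by rewrite ltW// divr_gt0.
have := q _ rz; have := q _ iz; nra.
Qed.

Lemma complex_cvgP (F : set_system T) {FF : Filter F} f (l : R[i]) :
  (f : T -> R[i]^o) @ F --> (l : R[i]^o) <->
  (fun x => Re (f x)) @ F --> Re l /\ (fun x => Im (f x)) @ F --> Im l.
Proof.
have ReB (u v : R[i]) : Re (u - v) = Re u - Re v by case: u v => [? ?] [? ?].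
have ImB (u v : R[i]) : Im (u - v) = Im u - Im v by case: u v => [? ?] [? ?].
split=> [/cvgrPdist_lt h|[/cvgrPdist_lt hr /cvgrPdist_lt hi]].
  split; apply/cvgrPdist_lt => e e0.
    have := h (e%:C%C); rewrite ltcR => /(_ e0); apply: filterS => x.
    by move=> /(normc_bounds _ e0).1[]; rewrite ReB.
  have := h (e%:C%C); rewrite ltcR => /(_ e0); apply: filterS => x.
  by move=> /(normc_bounds _ e0).1[]; rewrite ImB.
apply/cvgrPdist_lt => -[e e']; rewrite ltcE/= => /andP[/eqP -> e0].
have e20 : 0 < e / 2 by rewrite divr_gt0.
near=> x; apply: (normc_bounds _ e0).2; rewrite ?ReB ?ImB; near: x; [exact: hr|exact: hi].
Unshelve. all: by end_near. Qed.

Lemma complex_ctsP f : continuous (f : T -> R[i]^o) <->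
  continuous (fun x => Re (f x)) /\ continuous (fun x => Im (f x)).
Proof.
split=> [h|[hr hi] x]; last by apply/complex_cvgP; split; [exact: hr|exact: hi].
by split=> x; have /complex_cvgP[] := h x.
Qed.

End complex_continuity.

Section characters.
Variable R : realType.
Local Notation Re := complex.Re.
Local Notation Im := complex.Im.

Lemma circleP (z : R[i]) : circle z <-> Re z ^+ 2 + Im z ^+ 2 = 1.
Proof.
rewrite /circle /= normc_def; split=> [[h]|->]; last by rewrite sqrtr1.
by rewrite -[LHS]sqr_sqrtr ?h ?expr1n// addr_ge0// sqr_ge0.
Qed.

Lemma ReM (u v : R[i]) : Re (u * v) = Re u * Re v - Im u * Im v.
Proof. by case: u v => [? ?] [? ?]. Qed.

Lemma ImM (u v : R[i]) : Im (u * v) = Re u * Im v + Im u * Re v.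
Proof. by case: u v => [? ?] [? ?]. Qed.

Lemma circle_eq1 (z : R[i]) : circle z -> Re z = 1 -> z = 1.
Proof.
move=> /circleP + zr; rewrite zr => h; apply/eqP; rewrite eq_complex/= zr eqxx/=.
by rewrite -sqrf_eq0; apply/eqP; lra.
Qed.

Variable X : topologicalZmodType.
Hypothesis X_compact : compact [set: X].

(** The squared modulus [N] is multiplicative and, by compactness, bounded. Translation by [a] gives
    [sup N <= sup N / N a], so [N a <= 1]; the same at [- a] gives equality. *)
Lemma bounded_character (mu : X -> R[i]) :
    continuous (fun x => Re (mu x)) -> continuous (fun x => Im (mu x)) ->
    mu 0 = 1 -> (forall a b, mu (a + b) = mu a * mu b) -> dual mu.
Proof.
move=> cr ci mu0 muD; split=> //; first exact/complex_ctsP.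
pose N x := Re (mu x) ^+ 2 + Im (mu x) ^+ 2.
have ND a b : N (a + b) = N a * N b by rewrite /N muD ReM ImM; ring.
have N0 : N 0 = 1 by rewrite /N mu0/=; ring.
have Nge a : 0 <= N a by rewrite addr_ge0// sqr_ge0.
have Ngt a : 0 < N a.
  rewrite lt_neqAle Nge andbT; apply/eqP => Na0.
  by have := ND a (- a); rewrite subrr N0 -Na0 mul0r => /eqP; rewrite oner_eq0.
have [C NC] : exists C, forall x, `|N x| <= C.
  by apply: continuous_bounded => //; apply: ctsD; apply: ctsM.
have supN : has_sup (range N).
  split; first by exists (N 0), 0.
  by exists C => _ [x _ <-]; apply: le_trans (NC x); exact: ler_norm.
have Nsup a : N a <= sup (range N) by apply: sup_upper_bound => //; exists a.
have Nle1 a : N a <= 1.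
  have s0 : 0 < sup (range N) by exact: lt_le_trans (Nsup 0).
  have : sup (range N) <= sup (range N) / N a.
    apply: ge_sup; first by exists (N 0), 0.
    by move=> _ [b _ <-]; rewrite ler_pdivlMr// -ND.
  by rewrite ler_pdivlMr// ger_pMr.
move=> x; apply/circleP; apply/eqP; rewrite eq_le Nle1/=.
have := ND x (- x); rewrite subrr N0 => h; have := Nle1 (- x); rewrite -/(N x).
by have := Ngt x; nra.
Qed.

Section conv_eigenspace.
Variables (k : X -> R) (rho : R).
Hypothesis k_cont : continuous k.
Hypothesis rho_gt0 : 0 < rho.
Local Notation T := (conv k).

Definition conv_eigenspace : set (X -> R) :=
  [set f | continuous f /\ T (T f) = fun x => rho * f x].

Lemma eigenspace_comb a b f g : conv_eigenspace f -> conv_eigenspace g ->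
  conv_eigenspace (fun x => a * f x + b * g x).
Proof.
move=> [cf Tf] [cg Tg]; have ca := ctsZ (c := a) cf; have cb := ctsZ (c := b) cg.
split; first exact: ctsD.
have cTf := conv_cts X_compact k_cont cf; have cTg := conv_cts X_compact k_cont cg.
rewrite convD// !convZ// convD//; [|exact: ctsZ|exact: ctsZ].
by rewrite !convZ// Tf Tg; apply/funext => x; ring.
Qed.

Lemma eigenspace_translate a f : conv_eigenspace f -> conv_eigenspace (fun x => f (x + a)).
Proof.
move=> [cf Tf]; split; first by apply: cts_comp => //; exact: cts_addr.
by rewrite !conv_translate//; [rewrite Tf|exact: conv_cts].
Qed.

(* Elements of the eigenspace are equicontinuous relative to their sup norm, so
   their values on a fine enough net determine them. *)
Lemma eigenspace_net : exists s : seq X, forall f, conv_eigenspace f ->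
  (forall x, x \in s -> f x = 0) -> forall x, f x = 0.
Proof.
have [K kK] := continuous_bounded X_compact k_cont.
have K0 : 0 <= K by exact: le_trans (kK 0).
(* With this [d], [T (T f)] differs from its zero value at a net point by at most [rho * (S / 2)],
   which forces [S <= S / 2]. Adding 1 to [K] avoids a division by zero. *)
pose d := rho / 2 / (K + 1).
have d0 : 0 < d by rewrite !divr_gt0// ltr_wpDl.
have [W W0 WP] := uniform_continuity X_compact k_cont d0.
have [|s sP] := compact_net (U := fun a => [set z | W (z - a)]) X_compact.
  by move=> a; exact: nbhs_subl.
exists s => f [cf Tf] fs x.
have [C fC] := continuous_bounded X_compact cf.
have supf : has_sup (range (fun x => `|f x|)).
  by split; [exists `|f 0|, 0|exists C => _ [y _ <-]].
pose S := sup (range (fun x => `|f x|)).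
have fS y : `|f y| <= S by apply: sup_upper_bound => //; exists y.
have TfS y : `|T f y| <= K * S.
  apply: haar_norm_le => // [|z]; first exact: conv_integrand_cts.
  by rewrite normrM ler_pM.
have half y : `|f y| <= S / 2.
  have [a /fs fa /= Wa] := sP y.
  have : `|T (T f) y - T (T f) a| <= d * (K * S).
    rewrite /conv -/T; apply: haar_near => // [||z].
    - exact/conv_integrand_cts/conv_cts.
    - exact/conv_integrand_cts/conv_cts.
    rewrite -mulrBl normrM ler_pM//.
    - have -> : y - z = a - z + (y - a) by rewrite [RHS]addrC subrKA.
      exact: WP.
    - exact: TfS.
  rewrite Tf fa mulr0 subr0 normrM (gtr0_norm rho_gt0) => h.
  rewrite -(ler_pM2l rho_gt0) (le_trans h)//.
  have S0 : 0 <= S by exact: le_trans (fS 0).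
  have -> : rho * (S / 2) = d * ((K + 1) * S).
    by rewrite /d; field; rewrite gt_eqF// ltr_wpDl.
  by rewrite ler_pM2l// ler_wpM2r// lerDl.
have : S <= S / 2 by apply: ge_sup => [|_ [y _ <-]]; [exists `|f 0|, 0|].
by move=> S2; apply/eqP; rewrite -normr_le0; have := fS x; lra.
Qed.

(** The character is the multiplier [mu] of the translations. Being a translate of [chi] divided by
    [chi x1], it is continuous and its real part stays in the eigenspace; that membership ties the
    character to the kernel. *)
Lemma eigenspace_character (f0 : X -> R) x0 : conv_eigenspace f0 -> f0 x0 != 0 ->
  exists2 chi, dual chi & conv_eigenspace (fun x => Re (chi x)).
Proof.
move=> Vf0 f00; have [s sP] := eigenspace_net.
have [chi [Vr Vi [x1 x10] [mu muP]]] :=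
  invariant_space_character eigenspace_comb eigenspace_translate sP Vf0 f00.
have muE a : mu a = (chi x1)^-1 * chi (a + x1).
  by rewrite [a + x1]addrC muP mulrC mulfK.
have Vrm : conv_eigenspace (fun x => Re (mu x)).
  have := eigenspace_comb (Re (chi x1)^-1) (- Im (chi x1)^-1)
    (eigenspace_translate x1 Vr) (eigenspace_translate x1 Vi).
  by under eq_fun do rewrite mulNr -ReM -muE.
have Vim : conv_eigenspace (fun x => Im (mu x)).
  have := eigenspace_comb (Re (chi x1)^-1) (Im (chi x1)^-1)
    (eigenspace_translate x1 Vi) (eigenspace_translate x1 Vr).
  by under eq_fun do rewrite -ImM -muE.
exists mu => //; apply: bounded_character; [exact: Vrm.1|exact: Vim.1| |].
  by rewrite muE add0r mulVf.
move=> a b; apply: (mulIf x10).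
by rewrite -muP addrA muP muP mulrCA mulrA.
Qed.

End conv_eigenspace.

(* Peter-Weyl: take for kernel the second difference of [h]; on a character
   trivial at [x0] the associated operator vanishes. *)
Lemma character_separates (h : X -> R) (x0 : X) : continuous h ->
    (forall x, h (- x) = h x) -> h x0 != h 0 ->
  exists chi : X -> R[i], [/\ dual chi, chi x0 <> 1 &
    forall p, (forall x, h (x + p) = h x) -> chi p = 1].
Proof.
move=> ch he hx0.
pose k x := h (x + x0) + h (x - x0) - 2 * h x.
have ck : continuous k.
  by apply: ctsB; [apply: ctsD; apply: cts_comp => //; exact: cts_addr|exact: ctsZ].
have ke x : k (- x) = k x.
  rewrite /k -[h (- x + x0)]he -[h (- x - x0)]he !opprD !opprK he; ring.
have k0 : k 0 != 0.
  rewrite /k add0r sub0r he; apply: contra hx0 => /eqP k0; apply/eqP; lra.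
have [rho rho0 [g cg [g0 Tg]]] := conv_eigenvector X_compact ck ke k0.
have [chi dchi [cr Tr]] := eigenspace_character ck rho0 (conj cg Tg) g0.
have chi01 : chi 0 = 1.
  have [_ c1 cD] := dchi; have := cD 0 0; rewrite addr0 => /esym/eqP.
  rewrite -[X in _ == X]mulr1 => /eqP/mulfI; apply.
  apply/eqP => c0; have /circleP := c1 0; rewrite c0/= expr0n/= addr0 => /esym/eqP.
  by rewrite oner_eq0.
have r01 : Re (chi 0) = 1 by rewrite chi01.
exists chi; split=> // [chix0|p hp].
  have rx a y : chi a = 1 -> Re (chi (y + a)) = Re (chi y).
    by move=> ca; have [_ _ ->] := dchi; rewrite ca mulr1.
  have chiNx0 : chi (- x0) = 1.
    by have [_ _ cD] := dchi; have := cD x0 (- x0); rewrite subrr chi01 chix0 mul1r.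
  have Tr0 : conv k (fun x => Re (chi x)) = fun=> 0.
    apply/funext => x.
    have cvE a : chi a = 1 -> conv h (fun x => Re (chi x)) (x + a) = conv h (fun x => Re (chi x)) x.
      move=> ca; have := conv_translate X_compact ch a cr => /(congr1 (fun f => f x)) <-.
      by congr (conv h _ x); apply/funext => y; rewrite rx.
    transitivity (conv h (fun x => Re (chi x)) (x + x0) +
      conv h (fun x => Re (chi x)) (x - x0) - 2 * conv h (fun x => Re (chi x)) x).
      have ci y : continuous (fun z => h (y - z) * Re (chi z)) by exact: conv_integrand_cts.
      rewrite /conv -haarZ// -haarD// -haarB//; [|exact: ctsD|exact: ctsZ].
      congr haar; apply/funext => y; rewrite /k.
      by rewrite [x + x0 - y]addrAC [x - x0 - y]addrAC; ring.
    by rewrite !cvE//; ring.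
  have := congr1 (fun f => f 0) Tr; rewrite Tr0 /= r01 mulr1 /conv.
  under eq_fun do rewrite mulr0.
  by rewrite haar_cst => /esym/eqP; rewrite gt_eqF.
(* A period of [h] is a period of [k], hence of every convolution by [k], hence of the eigenfunction
   [Re chi]. *)
apply: circle_eq1; first by have [_ + _] := dchi; apply.
have kp x : k (x + p) = k x by rewrite /k hp ![x + p + _]addrAC !hp.
have Tp f x : conv k f (x + p) = conv k f x.
  by congr haar; apply/funext => y; rewrite addrAC kp.
have := congr1 (fun f => f (0 + p)) Tr; rewrite Tp Tr /= r01 => /(mulfI (lt0r_neq0 rho0)).
by rewrite add0r.
Qed.

End characters.

(** * The group of null sequences *)

Section metrics.
Variables (R : realType) (T : topologicalType) (d : T -> T -> R).
Hypothesis d_metric : metric_for d.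

Lemma metric_nbhsP x (A : set T) :
  nbhs x A <-> exists2 e : R, 0 < e & forall y, d x y < e -> A y.
Proof.
have [_ _ _ ->] := d_metric.
by split=> -[e e0 eA]; exists e => // y; exact: eA.
Qed.

Lemma metric0 x : d x x = 0.
Proof. by have [h _ _ _] := d_metric; apply/h. Qed.

Lemma metric_ge0 x y : 0 <= d x y.
Proof.
have [_ dC dT _] := d_metric.
by have := dT x y x; rewrite metric0 [d y x]dC; lra.
Qed.

Lemma metric_gt0 x y : x <> y -> 0 < d x y.
Proof.
move=> xy; rewrite lt_neqAle metric_ge0 andbT; apply/eqP => /esym.
by have [h _ _ _] := d_metric; move/h.
Qed.

Lemma metric_continuous : continuous (fun z : T * T => d z.1 z.2).
Proof.
have [_ dC dT _] := d_metric.
move=> [x y]; apply/cvgrPdist_le => e e0; have e20 : 0 < e / 2 by rewrite divr_gt0.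
exists ([set x' | d x x' < e / 2], [set y' | d y y' < e / 2]) => /=.
  by split; apply/metric_nbhsP; exists (e / 2).
move=> [x' y'] /= [xx' yy']; rewrite ler_norml.
have := dT x x' y; have := dT x' y' y; have := dT x' x y'; have := dT x y y'.
by rewrite [d x' x]dC [d y' y]dC; move=> *; apply/andP; split; lra.
Qed.

End metrics.

Lemma exists_lower_bound (R : realType) (T : eqType) (s : seq T) (e : T -> R) :
  (forall x, 0 < e x) -> exists2 e0, 0 < e0 & forall x, x \in s -> e0 <= e x.
Proof.
move=> e_gt0; elim: s => [|x s [e0 e0_gt0 e0P]]; first by exists 1.
exists (Num.min e0 (e x)); first by rewrite lt_min e0_gt0 e_gt0.
move=> y; rewrite inE ge_min => /orP[/eqP ->|/e0P ->//].
by rewrite lexx orbT.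
Qed.

(** * Comparison of the metric with the group structure *)

Section compact_metric_group.
Variables (R : realType) (X : topologicalZmodType) (d : X -> X -> R).
Hypothesis X_compact : compact [set: X].
Hypothesis d_metric : metric_for d.

(** The metric need not be translation invariant; compactness still makes smallness of [d x y] and
    of [y - x] uniformly comparable. *)
Lemma metric_of_translation (e : R) : 0 < e -> exists2 W, nbhs (0 : X) W &
  forall x y, W (y - x) -> d x y <= e.
Proof.
move=> e0; have [W W0 WP] :=
  uniform_translation X_compact X_compact (metric_continuous d_metric) e0.
exists W => // x y /(WP _ x x) /=.
have [_ dC _ _] := d_metric.
by rewrite subrKC metric0// subr0 ger0_norm ?metric_ge0// dC.
Qed.

(** A Lebesgue number argument: the halved radii on the net leave room for a second point, and both
    points differ from the same net point by an element of [W]. *)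
Lemma translation_of_metric (V : set X) : nbhs (0 : X) V ->
  exists2 e : R, 0 < e & forall x y, d x y < e -> V (y - x).
Proof.
move=> V0; have [W W0 WV] := nbhs0_split V0.
have /choice[e eP] x : exists e : R, 0 < e /\ forall y, d x y < e -> W (y - x).
  by have /(metric_nbhsP d_metric)[e e0 eW] := nbhs_subl x W0; exists e.
have [|s sP] := compact_net (U := fun a => [set x | d a x < e a / 2]) X_compact.
  move=> a; apply/(metric_nbhsP d_metric); exists (e a / 2) => //.
  by rewrite divr_gt0// (eP a).1.
have [|e0 e00 e0P] := @exists_lower_bound R X s (fun a => e a / 2).
  by move=> a; rewrite divr_gt0// (eP a).1.
exists e0 => // x y xy; have [a a_s /= ax] := sP x.
have [_ _ dT _] := d_metric.
have Wx : W (x - a) by apply: (eP a).2; have := (eP a).1; lra.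
have Wy : W (y - a).
  by apply: (eP a).2; have := dT a x y; have := e0P _ a_s; lra.
by rewrite -(subrKA a y (- x)) -[a - x]opprB; exact: (WV _ _ Wy Wx).2.
Qed.

End compact_metric_group.

Section c0_topology.
Variable X : topologicalZmodType.

Lemma c0_nbhsP (x : c0 X) (A : set (c0 X)) : nbhs x A <->
  exists2 V, nbhs (0 : X) V & forall y : c0 X, (forall n, V (val y n - val x n)) -> A y.
Proof.
split=> [|[V V0 VA]].
  case=> _ [[B Bo <-] Bx BA].
  have [V V0 VB] : nbhs (val x : uniform_seq X) B by exact: open_nbhs_nbhs.
  by exists V => // y Vy; apply: BA; exact: VB.
have : nbhs x (val @^-1` [set y : uniform_seq X | forall n, V (y n - val x n)]).
  by apply: (@initial_continuous _ _ (val : c0 X -> uniform_seq X)); exists V.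
by apply: filterS => y; exact: VA.
Qed.

Lemma c0_cvg (x : c0 X) (V : set X) : nbhs (0 : X) V ->
  exists N, forall n, (N <= n)%N -> V (val x n).
Proof.
move=> V0; have /asboolP/(_ V V0) := valP x.
by case=> N _ NP; exists N.
Qed.

Lemma trunc_in_c0 (u : nat -> X) N :
  (fun n => if (n < N)%N then u n else 0) \in @in_c0 X.
Proof.
apply/asboolP => V V0; exists N => // n /= Nn.
by rewrite ltnNge Nn/=; exact: nbhs_singleton.
Qed.

Definition trunc (u : nat -> X) N : c0 X :=
  exist (fun x : uniform_seq X => x \in @in_c0 X) _ (trunc_in_c0 u N).

Definition single (a : X) n : c0 X := trunc (fun m => if m == n then a else 0) n.+1.

Lemma truncE (u : nat -> X) N n : val (trunc u N) n = if (n < N)%N then u n else 0.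
Proof. by []. Qed.

Lemma singleE a n m : val (single a n) m = if m == n then a else 0.
Proof. by rewrite truncE; case: eqP => [->|]; rewrite ?ltnSn ?if_same. Qed.

Lemma c0D (x y : c0 X) n : val (x + y) n = val x n + val y n.
Proof. by []. Qed.

Lemma c0N (x : c0 X) n : val (- x) n = - val x n.
Proof. by []. Qed.

Lemma c00 n : val (0 : c0 X) n = 0 :> X.
Proof. by []. Qed.

Lemma c0_eqP (x y : c0 X) : (forall n, val x n = val y n) -> x = y.
Proof. by move=> xy; apply/val_inj/funext. Qed.

Lemma truncS (u : nat -> X) N : trunc u N.+1 = trunc u N + single (u N) N.
Proof.
apply: c0_eqP => n; rewrite c0D singleE !truncE ltnS leq_eqVlt.
by case: eqP => [->|_]/=; rewrite ?ltnn ?add0r ?addr0.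
Qed.

Lemma trunc0 (u : nat -> X) : trunc u 0 = 0.
Proof. exact: c0_eqP. Qed.

End c0_topology.

(** * Elementary properties of characters *)

Section characters_basics.
Variable R : realType.
Local Notation Re := complex.Re.
Local Notation Im := complex.Im.

Section group.
Variables (G : topologicalZmodType) (chi : G -> R[i]).
Hypothesis chi_dual : dual chi.

Lemma dualD x y : chi (x + y) = chi x * chi y. Proof. by case: chi_dual. Qed.

Lemma dual_circle x : circle (chi x). Proof. by case: chi_dual. Qed.

Lemma dual_norm x : `|chi x| = 1. Proof. exact: dual_circle. Qed.

Lemma dual_neq0 x : chi x != 0.
Proof. by rewrite -normr_eq0 dual_norm oner_eq0. Qed.

Lemma dual0 : chi 0 = 1.
Proof. by apply: (mulfI (dual_neq0 0)); rewrite -dualD addr0 mulr1. Qed.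

Lemma dualN x : chi (- x) = (chi x)^-1.
Proof. by apply: (mulfI (dual_neq0 x)); rewrite -dualD subrr dual0 mulfV ?dual_neq0. Qed.

Lemma dualMn x n : chi (x *+ n) = chi x ^+ n.
Proof. by elim: n => [|n IH]; rewrite ?dual0// mulrS dualD IH exprS. Qed.

Lemma dual_Re_cts : continuous (fun x => Re (chi x)).
Proof. by case: chi_dual => /complex_ctsP[]. Qed.

Lemma dual_Im_cts : continuous (fun x => Im (chi x)).
Proof. by case: chi_dual => /complex_ctsP[]. Qed.

Lemma dual_Re_pos : nbhs (0 : G) [set x | 0 < Re (chi x)].
Proof.
have /cvgr_gt := @dual_Re_cts 0; apply.
by rewrite dual0.
Qed.

End group.

Lemma dual_mul (G : topologicalZmodType) (chi psi : G -> R[i]) :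
  dual chi -> dual psi -> dual (fun x => chi x * psi x).
Proof.
move=> dc dp; split.
- apply/complex_ctsP; split.
    under eq_fun do rewrite ReM.
    by apply: ctsB; apply: ctsM; (exact: dual_Re_cts || exact: dual_Im_cts).
  under eq_fun do rewrite ImM.
  by apply: ctsD; apply: ctsM; (exact: dual_Re_cts || exact: dual_Im_cts).
- by move=> x; rewrite /circle/= normrM !dual_norm// mulr1.
- by move=> x y; rewrite !dualD//; ring.
Qed.

Lemma dual1 (G : topologicalZmodType) : dual (cst 1 : G -> R[i]).
Proof.
split=> [x|x|x y]; first exact: cvg_cst.
  by rewrite /circle/= normr1.
by rewrite mulr1.
Qed.

Lemma dual_exp (G : topologicalZmodType) (chi : G -> R[i]) n :
  dual chi -> dual (fun x => chi x ^+ n).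
Proof.
move=> dc; elim: n => [|n IH].
  by under eq_fun do rewrite expr0; exact: dual1.
by under eq_fun do rewrite exprS; exact: dual_mul.
Qed.

(* Doubling the angle doubles [1 - Re z] at least, as long as [Re z >= 0]. *)
Lemma circle_no_small_powers (z : R[i]) :
  circle z -> (forall n, 0 <= Re (z ^+ n)) -> z = 1.
Proof.
move=> cz zp; apply: circle_eq1 => //; apply/eqP; rewrite eq_le; apply/andP; split.
  by move/circleP : cz => ?; nra.
pose u n := z ^+ (2 ^ n).
have cu n : circle (u n) by rewrite /circle/= normrX cz expr1n.
have uS n : u n.+1 = u n * u n by rewrite /u -exprD addnn -mul2n -expnS.
have up n : 2 ^+ n * (1 - Re z) <= 1 - Re (u n).
  elim: n => [|n IH]; first by rewrite mul1r /u expr1.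
  have /circleP h := cu n; have := zp (2 ^ n)%N; rewrite -/(u n) => h0.
  by rewrite uS ReM exprS; nra.
have ub n : 2 ^+ n * (1 - Re z) <= 1.
  by apply: le_trans (up n) _; have := zp (2 ^ n)%N; rewrite -/(u n) => ?; lra.
rewrite leNgt; apply/negP => z1.
have e0 : 0 < 1 - Re z by lra.
have /cvgrPdist_lt/(_ _ e0)[N _ /(_ N (leqnn N))] := @cvg_expr R (2^-1) ltac:(by rewrite gtr0_norm; lra).
rewrite /= sub0r normrN exprVn ger0_norm ?invr_ge0 ?exprn_ge0//.
have n2 : 0 < 2 ^+ N :> R by rewrite exprn_gt0.
by rewrite -(ltr_pM2l n2) mulfV ?gt_eqF// ltNge ub.
Qed.

Lemma character_no_small_image (G : topologicalZmodType) (chi : G -> R[i]) :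
  dual chi -> (forall x, 0 <= Re (chi x)) -> chi = cst 1.
Proof.
move=> dc cp; apply/funext => x; apply: circle_no_small_powers => [|n].
  exact: dual_circle.
by rewrite -dualMn.
Qed.

Lemma dual_proj (X : topologicalZmodType) (xi : X -> R[i]) n :
  dual xi -> dual (fun x : c0 X => xi (val x n)).
Proof.
move=> [cxi xc xD]; split=> [x A|x|x y]; [|exact: xc|exact: xD].
move=> /(cxi (val x n)) xA; apply/c0_nbhsP.
have [/= V V0 VA] : exists2 V, nbhs (0 : X) V & forall w, V w -> A (xi (val x n + w)).
  exists [set w | A (xi (val x n + w))] => //.
  have : (fun w => val x n + w) @ (0 : X) --> val x n + 0.
    by apply: cvg_zmodD; [exact: cvg_cst|exact: cvg_id].
  by rewrite addr0 => h; exact: (h _ xA).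
by exists V => // y /(_ n)/VA; rewrite subrKC.
Qed.

End characters_basics.

(** Two distinct elements [single a n] have a difference with a coordinate [a], outside [U], so no
    translate of a neighborhood given by [W] with [W - W] inside [U] contains both. *)
Lemma c0_not_precompact (X : topologicalZmodType) (a : X) (U : set X) :
  nbhs (0 : X) U -> ~ U a -> ~ precompact_group (c0 X).
Proof.
move=> U0 Ua pX; have [W W0 WU] := nbhs0_split U0.
have [|F finF FE] := pX [set y | forall n, W (val y n)].
  by apply/c0_nbhsP; exists W => // y yW n; have := yW n; rewrite c00 subr0.
have /choice[f fP] n : exists x, F x /\ forall m, W (val (single a n) m - val x m).
  have : [set: c0 X] (single a n) by [].
  rewrite FE => -[x Fx [y Wy xy]]; exists x; split=> // m.
  by rewrite -xy c0D addrC addKr; exact: Wy.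
have f_inj : injective f.
  move=> n m fnm; apply: contrapT => nm.
  have := (fP n).2 n; have := (fP m).2 n; rewrite !singleE eqxx fnm.
  case: eqP => [//|_] W1 W2; have := (WU _ _ W2 W1).2.
  by rewrite sub0r opprK subrK.
apply: infinite_nat; apply: card_le_finite finF.
apply: card_le_trans (subset_card_le (A := range f) _); last by move=> _ [n _ <-]; exact: (fP n).1.
suff: [set: nat] #= range f by rewrite card_eq_le => /andP[].
by rewrite card_eq_sym; apply: inj_card_eq => n m _ _; exact: f_inj.
Qed.

(** * Separation of points and local quasi-convexity *)

Section quasi_convexity.
Variables (R : realType) (X : topologicalZmodType) (d : X -> X -> R).
Hypothesis X_compact : compact [set: X].
Hypothesis d_metric : metric_for d.
Local Notation Re := complex.Re.

Lemma character_point_separation (x : X) : x <> 0 ->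
  exists2 chi : X -> R[i], dual chi & chi x <> 1.
Proof.
(* The distance to 0, symmetrised because [character_separates] needs an even function. *)
move=> x0; pose h (y : X) := d y 0 + d (- y) 0.
have ch : continuous h.
  have cd : continuous (fun y => d y 0).
    apply: (@cts_comp _ _ _ (fun y : X => (y, 0)) (fun z => d z.1 z.2)).
      by move=> y; apply: cvg_pair; [exact: cvg_id|exact: cvg_cst].
    exact: metric_continuous.
  exact: ctsD cd (cts_comp (@cts_opp X) cd).
have [||chi [dchi chix _]] := character_separates X_compact ch (x0 := x).
- by move=> y; rewrite /h opprK addrC.
- rewrite /h oppr0 metric0// addr0 gt_eqF// ltr_wpDr ?metric_ge0//.
  exact: metric_gt0.
by exists chi.
Qed.

Lemma character_negative (x : X) : x <> 0 ->
  exists2 chi : X -> R[i], dual chi & Re (chi x) < 0.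
Proof.
move=> /character_point_separation[chi dchi chix]; apply: contrapT => h; apply: chix.
apply: circle_no_small_powers; first exact: dual_circle.
move=> n; rewrite leNgt; apply/negP => rn; apply: h.
by exists (fun y => chi y ^+ n) => //; exact: dual_exp.
Qed.

(** A character negative at a point outside the interior of [U] is negative nearby, so finitely many
    such characters exclude all these points. The set where they all have nonnegative real part is
    quasi-convex by construction. *)
Lemma compact_locally_quasi_convex : locally_quasi_convex R X.
Proof.
move=> U U0; have U00 : U° 0 by [].
have /choice[psi psiP] x : exists psi : X -> R[i],
    dual psi /\ (~ U° x -> Re (psi x) < 0).
  have [Ux|Ux] := pselect (U° x); first by exists (cst 1); split; [exact: dual1|].
  have [|chi dchi chix] := @character_negative x; first by move=> x0; rewrite x0 in Ux.
  by exists chi.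
(* Points of the interior carry the trivial character, which imposes no constraint. *)
pose N x := [set y | (U° x /\ U° y) \/ Re (psi x y) < 0].
have [|s sP] := compact_net (U := N) X_compact.
  move=> x; have [Ux|Ux] := pselect (U° x).
    have : nbhs x U° by apply: open_nbhs_nbhs; split=> //; exact: open_interior.
    by apply: filterS => y; left.
  have /cvgr_lt := dual_Re_cts (psiP x).1 (x := x).
  by move=> /(_ 0 ((psiP x).2 Ux)); apply: filterS => y; right.
exists [set y | forall x, x \in s -> 0 <= Re (psi x y)]; split.
- elim: s {sP} => [|x s IH]; first by apply: filterS filterT.
  apply: filterS (filterI (dual_Re_pos (psiP x).1) IH) => y [/= xy sy] z.
  by rewrite inE => /orP[/eqP ->|/sy//]; exact: ltW.
- move=> y /= ys; have [x /ys px [[_ /interior_subset//]|]] := sP y.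
  by rewrite ltNge px.
- move=> y /= ys; apply: contrapT => h; apply: ys => x xs.
  rewrite leNgt; apply/negP => px; apply: h; exists (psi x); first exact: (psiP x).1.
  split=> [_ [z zs <-]|[_]]; last by rewrite leNgt px.
  by split; [exact: dual_circle (psiP x).1 z|exact: zs].
Qed.

Lemma c0_locally_quasi_convex : locally_quasi_convex R (c0 X).
Proof.
move=> U /c0_nbhsP[V V0 VU].
have [A [A0 AV qA]] := compact_locally_quasi_convex V0.
exists [set x | forall n, A (val x n)]; split.
- by apply/c0_nbhsP; exists A => // y Ay n; have := Ay n; rewrite c00 subr0.
- by move=> x Ax; apply: VU => n; rewrite c00 subr0; apply: AV; exact: Ax.
move=> x /= /existsNP[n xn]; have [chi dchi [chiA chix]] := qA _ xn.
exists (fun x : c0 X => chi (val x n)); first exact: dual_proj.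
by split=> // _ [y Ay <-]; apply: chiA; exists (val y n) => //; exact: Ay.
Qed.

End quasi_convexity.

(** * The sup metric: completeness and separability *)

Section polish_group.
Variables (R : realType) (X : topologicalZmodType) (d : X -> X -> R).
Hypothesis X_compact : compact [set: X].
Hypothesis d_metric : metric_for d.

Definition sup_metric (x y : c0 X) : R := sup (range (fun n => d (val x n) (val y n))).

Lemma metric_bounded : exists C, forall x y, d x y <= C.
Proof.
have cd : continuous (fun y => d y 0).
  apply: (@cts_comp _ _ _ (fun y : X => (y, 0)) (fun z => d z.1 z.2)).
    by move=> y; apply: cvg_pair; [exact: cvg_id|exact: cvg_cst].
  exact: metric_continuous.
have [C CP] := continuous_bounded X_compact cd.
exists (C + C) => x y; have [_ dC dT _] := d_metric.
rewrite (le_trans (dT x 0 y))// lerD// ?[d 0 y]dC (le_trans (ler_norm _))//.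
Qed.

Lemma sup_metric_ge (x y : c0 X) n : d (val x n) (val y n) <= sup_metric x y.
Proof.
have [C CP] := metric_bounded.
apply: sup_upper_bound; last by exists n.
by split; [exists (d (val x 0%N) (val y 0%N)), 0%N|exists C => _ [m _ <-]].
Qed.

Lemma sup_metric_le (x y : c0 X) e :
  (forall n, d (val x n) (val y n) <= e) -> sup_metric x y <= e.
Proof.
move=> xye; apply: ge_sup; first by exists (d (val x 0%N) (val y 0%N)), 0%N.
by move=> _ [n _ <-].
Qed.

Lemma sup_metric_metric : metric_for sup_metric.
Proof.
have [d0 dC dT _] := d_metric; split.
- move=> x y; split=> [xy|->].
    apply: c0_eqP => n; apply/d0/eqP; rewrite eq_le (metric_ge0 d_metric) andbT -xy.
    exact: sup_metric_ge.
  apply/eqP; rewrite eq_le; apply/andP; split.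
    by apply: sup_metric_le => n; rewrite metric0.
  by rewrite -(metric0 d_metric (val y 0%N)); exact: sup_metric_ge.
- by move=> x y; rewrite /sup_metric; under eq_fun do rewrite dC.
- move=> x y z; apply: sup_metric_le => n.
  by rewrite (le_trans (dT _ (val y n) _))// lerD// sup_metric_ge.
move=> x; apply/funext => A; apply/propext; split=> [/c0_nbhsP[V V0 VA]|[e /= e0 eA]].
  have [e e0 eP] := translation_of_metric X_compact d_metric V0.
  exists e => // y /= xy; apply: VA => n; apply: eP.
  exact: le_lt_trans (sup_metric_ge _ _ _) xy.
have e20 : 0 < e / 2 by rewrite divr_gt0.
have [W W0 WP] := metric_of_translation X_compact d_metric e20.
apply/c0_nbhsP; exists W => // y Wy; apply: eA => /=.
apply: (@le_lt_trans _ _ (e / 2)); last lra.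
by apply: sup_metric_le => n; exact: WP.
Qed.

Lemma compact_complete_metric : complete_metric d.
Proof.
move=> v vC; have [_ dC dT _] := d_metric.
have [l [_ lP]] := @X_compact (v @ \oo) _ filterT.
exists l => A /(metric_nbhsP d_metric)[e e0 eA].
have e20 : 0 < e / 2 by rewrite divr_gt0.
have [N NP] := vC _ e20.
have [||y [[m /= Nm <-] lm]] := lP [set v n | n in [set n | (N <= n)%N]] [set y | d l y < e / 2].
- by exists N => // n Nn; exists n.
- by apply/(metric_nbhsP d_metric); exists (e / 2).
exists N => // n /= Nn; apply: eA; have := dT l (v m) (v n); have := NP m n Nm Nn.
by move: lm => /=; lra.
Qed.

Lemma sup_metric_complete : complete_metric sup_metric.
Proof.
move=> u uC; have [_ dC dT _] := d_metric.
have /choice[l lP] n : exists l : X, (fun k => val (u k) n) @ \oo --> l.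
  apply: compact_complete_metric => e /uC[N NP]; exists N => m k Nm Nk.
  exact: le_lt_trans (sup_metric_ge _ _ _) (NP m k Nm Nk).
have ul e : 0 < e -> exists N, forall k n, (N <= k)%N -> d (val (u k) n) (l n) <= e.
  move=> e0; have e20 : 0 < e / 2 by rewrite divr_gt0.
  have [N NP] := uC _ e20; exists N => k n Nk.
  have [|M _ MP] := lP n [set y | d (l n) y < e / 2].
    by apply/(metric_nbhsP d_metric); exists (e / 2).
  have /= h1 := MP (maxn M N) (leq_maxl _ _).
  have h2 := NP k (maxn M N) Nk (leq_maxr _ _).
  have h3 := sup_metric_ge (u k) (u (maxn M N)) n.
  have := dT (val (u k) n) (val (u (maxn M N)) n) (l n).
  by rewrite [d (val (u (maxn M N)) n) (l n)]dC => ?; lra.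
have lc0 : (l : uniform_seq X) \in @in_c0 X.
  apply/asboolP => V /(metric_nbhsP d_metric)[e e0 eV].
  have e20 : 0 < e / 2 by rewrite divr_gt0.
  have [N NP] := ul _ e20.
  have [|M MP] := c0_cvg (u N) (V := [set y | d 0 y < e / 2]).
    by apply/(metric_nbhsP d_metric); exists (e / 2).
  exists M => // n /= /MP /= Mn; apply: eV.
  by have := dT 0 (val (u N) n) (l n); have := NP N n (leqnn N); lra.
exists (exist (fun x : uniform_seq X => x \in @in_c0 X) _ lc0) => A.
move=> /(metric_nbhsP sup_metric_metric)[e e0 eA].
have e20 : 0 < e / 2 by rewrite divr_gt0.
have [N NP] := ul _ e20; exists N => // k /= Nk; apply: eA.
apply: (@le_lt_trans _ _ (e / 2)); last lra.
by apply: sup_metric_le => n /=; rewrite dC; exact: NP.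
Qed.

(** The dense set consists of finitely supported sequences with values in nets of mesh
    [1 / (k + 1)]. A value is coded by a net and a position in it, a sequence by a list of such
    pairs. *)
Lemma c0_separable : separable (c0 X).
Proof.
have [_ dC dT _] := d_metric.
have /choice[s sP] k : exists s : seq X, forall y, exists2 x, x \in s & d x y < k.+1%:R^-1.
  apply: compact_net => // x; apply/(metric_nbhsP d_metric).
  by exists k.+1%:R^-1 => //; rewrite invr_gt0.
pose pt (c : nat * nat) := nth 0 (s c.1) c.2.
pose elt (l : seq (nat * nat)) : c0 X := trunc (fun i => pt (nth (0%N, 0%N) l i)) (size l).
exists (range elt); first exact: sub_countable (card_image_le _ _) (countableP _).
move=> O [x Ox] Oo.
have /(metric_nbhsP sup_metric_metric)[e e0 eO] : nbhs x O by exact: open_nbhs_nbhs.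
have e20 : 0 < e / 2 by rewrite divr_gt0.
have [N NP] : exists N, forall n, (N <= n)%N -> d 0 (val x n) < e / 2.
  by apply: (c0_cvg x (V := [set y | d 0 y < e / 2])); apply/(metric_nbhsP d_metric); exists (e / 2).
have /choice[c cP] y : exists c, d (pt c) y < e / 2.
  have [k ke] : exists k : nat, k.+1%:R^-1 < e / 2.
    have /cvgrPdist_lt/(_ _ e20)[k _ /(_ k (leqnn k))] := @cvg_harmonic R.
    by rewrite /= sub0r normrN ger0_norm ?invr_ge0// => ?; exists k.
  have [z /(nthP 0)[j js <-] zy] := sP k y.
  by exists (k, j); exact: lt_trans zy ke.
exists (elt (mkseq (fun n => c (val x n)) N)); split; last by eexists.
apply: eO; apply: (@le_lt_trans _ _ (e / 2)); last lra.
apply: sup_metric_le => n; rewrite truncE size_mkseq dC.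
case: ltnP => nN; last exact/ltW/NP.
by rewrite nth_mkseq//; exact/ltW/cP.
Qed.

Lemma c0_polish : polish R (c0 X).
Proof.
split; first exact: c0_separable.
by exists sup_metric; [exact: sup_metric_metric|exact: sup_metric_complete].
Qed.

End polish_group.

(** * Characters of the group of null sequences *)

Section connected_case.
Variables (R : realType) (X : topologicalZmodType).
Hypothesis X_compact : compact [set: X].
Local Notation Re := complex.Re.
Local Notation Im := complex.Im.

(** The set [H] of finite sums from [V] is clopen, hence everything. A finite net bounds the
    lengths, with one extra summand joining a point to the net. *)
Lemma connected_generated (V : set X) : connected [set: X] -> nbhs (0 : X) V ->
  exists K, forall x, exists2 s : seq X, (size s <= K)%N &
    (forall a, a \in s -> V a) /\ x = \sum_(a <- s) a.
Proof.
move=> X_conn V0.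
pose H := [set x : X | exists2 s : seq X, forall a, a \in s -> V a & x = \sum_(a <- s) a].
have HV x y : H x -> V (y - x) -> H y.
  move=> [s sV ->] Vy; exists (y - \sum_(a <- s) a :: s); last by rewrite big_cons subrK.
  by move=> a; rewrite inE => /orP[/eqP ->|/sV].
have Ho : open H.
  rewrite openE => x Hx; have := nbhs_subl x V0; apply: filterS => y; exact: HV.
have Hc : closed H.
  rewrite -openC openE => x Hx; have := nbhs_subr x V0; apply: filterS => y /= Vy Hy.
  by apply: Hx; exact: HV Vy.
have HT : H = [set: X].
  apply: X_conn; [|by exists H; rewrite ?setTI|by exists H; rewrite ?setTI].
  by exists 0, [::]; rewrite ?big_nil.
have /choice[s sP] x : exists s : seq X, (forall a, a \in s -> V a) /\ x = \sum_(a <- s) a.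
  have : H x by rewrite HT.
  by move=> [s ? ?]; exists s.
have [|t tP] := compact_net (U := fun x => [set y | V (y - x)]) X_compact.
  by move=> x; exact: nbhs_subl.
exists (\sum_(x <- t) size (s x)).+1 => y; have [x xt /= Vy] := tP y.
exists (y - x :: s x); first by rewrite /= ltnS (big_rem x)//= leq_addr.
split; last by rewrite big_cons -(sP x).2 subrK.
by move=> a; rewrite inE => /orP[/eqP ->//|]; exact: (sP x).1.
Qed.

Lemma circle_near1 (z : R[i]) (e : R) : 0 < e -> circle z ->
  1 - e ^+ 2 / 2 <= Re z -> `|z - 1| <= e%:C%C.
Proof.
move=> e0 /circleP cz ze; rewrite normc_def lecR -[leRHS](gtr0_norm e0) -sqrtr_sqr.
rewrite ler_sqrt ?sqr_ge0//; case: z cz ze => a b /= cz ze.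
by rewrite subr0; nra.
Qed.

Lemma near1_Re_ge0 (z : R[i]) : `|z - 1| <= 1 -> 0 <= Re z.
Proof.
rewrite normc_def -[1]/(1%:C)%C lecR -[X in _ <= X]sqrtr1 ler_sqrt ?ltr01//.
case: z => a b /=; rewrite subr0 => h.
by have := sqr_ge0 b; nra.
Qed.

Lemma dual_sum (xi : X -> R[i]) (s : seq X) (e : R[i]) : dual xi ->
  (forall a, a \in s -> `|xi a - 1| <= e) -> `|xi (\sum_(a <- s) a) - 1| <= e *+ size s.
Proof.
move=> dx; elim: s => [|a s IH] se.
  by rewrite big_nil dual0// subrr normr0.
rewrite big_cons dualD//= mulrS.
have -> : xi a * xi (\sum_(j <- s) j) - 1 =
    xi a - 1 + xi a * (xi (\sum_(j <- s) j) - 1) by ring.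
apply: (le_trans (ler_normD _ _)); rewrite lerD//; first by rewrite se// mem_head.
rewrite normrM dual_norm// mul1r IH// => b bs.
by rewrite se// inE bs orbT.
Qed.

Lemma connected_nontrivial (V : set X) : connected [set: X] -> nbhs (0 : X) V ->
  exists2 eta : R, 0 < eta <= 1 & forall xi : X -> R[i], dual xi -> xi <> cst 1 ->
    exists2 v, V v & Re (xi v) < 1 - eta.
Proof.
move=> X_conn V0; have [K KP] := connected_generated X_conn V0.
have K0 : 0 < K.+1%:R :> R by [].
pose e : R := K.+1%:R^-1.
have e0 : 0 < e by rewrite invr_gt0.
have e1 : e <= 1 by rewrite invf_le1// ler1n.
(* On the circle [|z - 1| ^+ 2 = 2 - 2 * Re z]. If the real part never drops below [1 - eta] on [V],
   then [xi] is within [e] of 1 there, so within [K * e <= 1] of 1 everywhere, and it is trivial. *)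
exists (e ^+ 2 / 2); first by apply/andP; split; nra.
move=> xi dx xi1; apply: contrapT => h; apply: xi1.
apply: character_no_small_image => // x; apply: near1_Re_ge0.
have [s sK [sV ->]] := KP x.
have /le_trans -> // : `|xi (\sum_(a <- s) a) - 1| <= e%:C%C *+ size s.
  apply: dual_sum => // a /sV Va; apply: circle_near1 => //; first exact: dual_circle.
  by rewrite leNgt; apply/negP => ha; apply: h; exists a.
rewrite -rmorphMn -[1]/(1%:C)%C lecR -mulr_natr /e mulrC ler_pdivrMr// mul1r ler_nat.
exact: leq_trans sK (leqnSn K).
Qed.

Lemma dual_single (chi : c0 X -> R[i]) n : dual chi -> dual (fun a => chi (single a n)).
Proof.
move=> dc; have [cc _ _] := dc; split=> [a A|a|a b]; last 2 first.
- exact: dual_circle.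
- rewrite -dualD//; congr chi; apply: c0_eqP => m.
  by rewrite c0D !singleE; case: ifP; rewrite ?addr0.
move=> /(cc (single a n))/c0_nbhsP[V V0 VA].
have := nbhs_subl a V0; apply: filterS => b Vb; apply: VA => m.
by rewrite !singleE; case: ifP => // _; rewrite subrr; exact: nbhs_singleton.
Qed.

(* Along a sum of elements with small coordinates in which the characters of
   the coordinates are not small, the real part decreases by a fixed amount at
   each step although it must stay positive. *)
Lemma connected_eventually_trivial (chi : c0 X -> R[i]) :
  connected [set: X] -> dual chi ->
  exists N, forall n a, (N <= n)%N -> chi (single a n) = 1.
Proof.
move=> X_conn dc.
have /c0_nbhsP[V V0 VP] := dual_Re_pos dc.
(* Symmetry allows [v] to be replaced by [- v], which conjugates the value of the character, so that
   imaginary parts can be taken nonnegative. *)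
pose W := [set v | V v /\ V (- v)].
have W0 : nbhs (0 : X) W.
  apply: filterI => //; have := nbhs_subr (0 : X) V0.
  by apply: filterS => v /=; rewrite sub0r.
have chi_pos x : (forall n, W (val x n)) -> 0 < Re (chi x).
  by move=> xW; apply: VP => n; rewrite c00 subr0; exact: (xW n).1.
have W00 : W 0 by exact: nbhs_singleton.
have [eta /andP[eta0 eta1] etaP] := connected_nontrivial X_conn W0.
apply: contrapT => h.
have step N : exists n v, [/\ (N <= n)%N, W v, 0 <= Im (chi (single v n)) &
    Re (chi (single v n)) < 1 - eta].
  have [n Nn [v Wv vn]] : exists2 n, (N <= n)%N &
      exists2 v, W v & Re (chi (single v n)) < 1 - eta.
    apply: contrapT => hN; apply: h; exists N => n a Nn; apply: contrapT => na.
    apply: hN; exists n => //; apply: (etaP _ (dual_single n dc)).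
    by move=> /(congr1 (fun f => f a)).
  have [iv|iv] := leP 0 (Im (chi (single v n))); first by exists n, v.
  exists n, (- v); split=> //; first by case: Wv => ? ?; split=> //; rewrite opprK.
  - have -> : single (- v) n = - single v n.
      by apply: c0_eqP => m; rewrite c0N !singleE; case: ifP; rewrite ?oppr0.
    rewrite dualN//; have /circleP := dual_circle dc (single v n).
    case: (chi _) iv => a b /= b0 ab; rewrite /GRing.inv/=.
    by rewrite ab divr1; lra.
  have -> : single (- v) n = - single v n.
    by apply: c0_eqP => m; rewrite c0N !singleE; case: ifP; rewrite ?oppr0.
  rewrite dualN//; have /circleP := dual_circle dc (single v n).
  by case: (chi _) vn => a b /= ae ab; rewrite /GRing.inv/= ab divr1.
(* Finite support leaves a fresh coordinate for the next step. The start 0 has imaginary part 0, so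
   the bound [1 - eta], which makes the imaginary part at least [eta], is required only from [j = 1]
   on. *)
have claim j : exists x : c0 X, [/\ forall n, W (val x n),
    exists N, forall n, (N <= n)%N -> val x n = 0,
    0 <= Im (chi x), Re (chi x) <= 1 - j%:R * eta ^+ 2 &
    (0 < j)%N -> Re (chi x) <= 1 - eta].
  elim: j => [|j [x [xW [N xN] xi xr xj]]].
    exists 0; split=> //; first by exists 0%N.
      by rewrite dual0.
    by rewrite dual0//= mul0r subr0.
  have [n [v [Nn Wv vi vr]]] := step N.
  have xnv m : val (x + single v n) m = if m == n then v else val x m.
    rewrite c0D singleE; case: eqP => [->|]; rewrite ?addr0// xN ?add0r//.
  exists (x + single v n).
  have sW m : W (val (single v n) m) by rewrite singleE; case: ifP.
  have pv := chi_pos _ sW; have px := chi_pos _ xW.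
  have /circleP := dual_circle dc x; have /circleP := dual_circle dc (single v n).
  rewrite dualD// ReM ImM; move: pv px vi vr xi xr xj.
  set a := Re (chi (single v n)); set b := Im (chi (single v n)).
  set p := Re (chi x); set q := Im (chi x) => pv px vi vr xi xr xj ab pq.
  have p1 : p <= 1 by nra.
  have le1 : p * a - q * b <= 1 - eta.
    by rewrite lerBlDr (le_trans (ler_piMl (ltW pv) p1))// (le_trans (ltW vr))// lerDl mulr_ge0.
  (* From [0 < a < 1 - eta] follows [b ^+ 2 = 1 - a ^+ 2 >= eta], and [b >= b ^+ 2]. The same holds
     for [q] after the first step, so [q * b] lowers the real part by at least [eta ^+ 2]. *)
  have b_ge : eta <= b.
    have b1 : b <= 1 by nra.
    have : eta <= b ^+ 2 by nra.
    by nra.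
  split=> //.
  - by move=> m; rewrite xnv; case: ifP.
  - exists n.+1 => m nm; rewrite xnv gtn_eqF// xN//.
    by rewrite (leq_trans Nn)// ltnW.
  - by rewrite addr_ge0// mulr_ge0// ltW.
  case: j xr xj => [_ _|j xr /(_ isT) xj].
    by rewrite mul1r; nra.
  have q_ge : eta <= q.
    have q1 : q <= 1 by nra.
    have : eta <= q ^+ 2 by nra.
    by nra.
  rewrite mulrS mulrDl mul1r opprD addrCA -lerBlDl.
  have : p * a <= p by nra.
  have : eta ^+ 2 <= q * b by rewrite expr2 ler_pM// ltW.
  by lra.
have [j jP] : exists j : nat, 1 < j%:R * eta ^+ 2.
  have e20 : 0 < eta ^+ 2 by rewrite exprn_gt0.
  exists (Num.truncn (eta ^+ 2)^-1).+1.
  by rewrite -ltr_pdivrMr// mul1r; exact: truncnS_gt.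
have [x [xW _ _ xr _]] := claim j.
by have := chi_pos _ xW; lra.
Qed.

Lemma dual_trunc (chi : c0 X -> R[i]) (u : nat -> X) N : dual chi ->
  chi (trunc u N) = \prod_(n < N) chi (single (u n) n).
Proof.
move=> dc; elim: N => [|N IH]; first by rewrite big_ord0 trunc0 dual0.
by rewrite truncS dualD// IH big_ord_recr.
Qed.

Lemma trunc_dense (x : c0 X) (A : set (c0 X)) N : nbhs x A ->
  exists2 M, (N <= M)%N & A (trunc (val x) M).
Proof.
move=> /c0_nbhsP[V V0 VA].
have V0' : nbhs (0 : X) [set v | V (- v)].
  by have := nbhs_subr (0 : X) V0; apply: filterS => v /=; rewrite sub0r.
have [M MP] := c0_cvg x V0'; exists (maxn N M); first exact: leq_maxl.
apply: VA => n; rewrite truncE; case: ltnP => nM.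
  by rewrite subrr; exact: nbhs_singleton.
by rewrite sub0r; apply: MP; rewrite (leq_trans (leq_maxr N M)).
Qed.

(** Truncations converge to [x], so the values on them determine a continuous character. *)
Lemma dual_eq_trunc (chi : c0 X -> R[i]) (x : c0 X) z N : dual chi ->
  (forall M, (N <= M)%N -> chi (trunc (val x) M) = z) -> chi x = z.
Proof.
move=> dc xz; apply/eqP; rewrite eq_complex; apply/andP.
split; rewrite -subr_eq0 -normr_le0; apply/ler_addgt0Pr => e e0; rewrite add0r.
  have /cvgrPdist_le/(_ _ e0)/(trunc_dense N)[M NM /=] := dual_Re_cts dc (x := x).
  by rewrite xz.
have /cvgrPdist_le/(_ _ e0)/(trunc_dense N)[M NM /=] := dual_Im_cts dc (x := x).
by rewrite xz.
Qed.

Lemma chi_ofE (h : nat -> X -> R[i]) (x : c0 X) N :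
  (forall n, (N <= n)%N -> h n (val x n) = 1) -> chi_of h x = \prod_(n < N) h n (val x n).
Proof.
move=> hN; rewrite /chi_of (fsbig_ord _ N (fun n => h n (val x n))); symmetry.
by apply: fsbig_widen => // n [_ /= /negP]; rewrite -leqNgt => /hN.
Qed.

Lemma connected_dual_finsupp : connected [set: X] ->
  set_surj (@finsupp_dual R X) (@dual R (c0 X)) (@chi_of R X).
Proof.
move=> X_conn chi dc; have [N NP] := connected_eventually_trivial X_conn dc.
exists (fun n a => chi (single a n)).
  split=> [n|]; first exact: dual_single.
  apply: (@sub_finite_set _ _ `I_N); last exact: finite_II.
  move=> n /= hn; rewrite ltnNge; apply/negP => Nn; apply: hn.
  by apply/funext => a; exact: NP.
apply/funext => x; rewrite (@chi_ofE _ x N) => [|n Nn]; last exact: NP.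
symmetry; apply: (dual_eq_trunc (N := N)) => // M NM; rewrite dual_trunc//.
rewrite -(subnKC NM) big_split_ord/= [X in _ * X]big1 ?mulr1// => i _.
by rewrite NP// leq_addr.
Qed.

End connected_case.

(** * Cardinality of dual groups *)

Section cardinality.
Variable R : realType.
Local Notation Re := complex.Re.
Local Notation Im := complex.Im.

Lemma injection_card_le (T U : Type) (A : set T) (B : set U) (f : T -> U) :
  {in A &, injective f} -> (forall x, A x -> B (f x)) -> A #<= B.
Proof.
move=> f_inj fAB; have := inj_card_eq f_inj; rewrite card_eq_sym card_eq_le => /andP[+ _].
by move=> /card_le_trans; apply; apply: subset_card_le => _ [x /fAB ? <-].
Qed.

Lemma uncountable_reals : ~ countable [set: R].
Proof.
move=> cR; have : lebesgue_measure (`[0, 1]%classic : set R) = 0%E.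
  by apply: countable_lebesgue_measure0; apply: sub_countable cR; exact: card_leT.
rewrite lebesgue_measure_itv /= lte_fin ltr01 oppr0 adde0 => /eqP.
by rewrite eqe oner_eq0.
Qed.

Lemma countable_small_card (T : Type) (A : set T) :
  A #= [set: nat] -> A #<= [set: R] /\ ~ (A #= [set: R]).
Proof.
move=> AN; split.
  rewrite (card_le_eql AN); apply: (injection_card_le (f := fun n : nat => n%:R)) => //.
  by move=> n m _ _ /eqP; rewrite eqr_nat => /eqP.
move=> AR; apply: uncountable_reals; rewrite -(eq_countable AR) (eq_countable AN).
exact: countableP.
Qed.

Lemma dual_opp (G : topologicalZmodType) (chi : G -> R[i]) :
  dual chi -> dual (fun x => chi (- x)).
Proof.
move=> dc; split=> [|x|x y]; last 2 first.
- exact: dual_circle.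
- by rewrite opprD dualD.
apply/complex_ctsP; split.
  exact: cts_comp (@cts_opp G) (dual_Re_cts dc).
exact: cts_comp (@cts_opp G) (dual_Im_cts dc).
Qed.

Lemma floor_near (x y : R) : Num.floor x = Num.floor y -> `|x - y| < 1.
Proof.
move=> xy; have /andP[] := floor_itv x; have /andP[] := floor_itv y.
by rewrite xy !intrD ltr_norml => *; apply/andP; split; lra.
Qed.

Section compact_metric.
Variables (X : topologicalZmodType) (d : X -> X -> R).
Hypothesis X_compact : compact [set: X].
Hypothesis d_metric : metric_for d.

(** The quotient of the two characters stays within 1/4 + 1/2 + 1/4 = 1 of 1, so it takes values in
    the right half of the circle and is trivial. *)
Lemma close_characters_eq (W : set X) (s : seq X) (chi psi : X -> R[i]) :
    (forall x, exists2 a, a \in s & W (x - a)) -> dual chi -> dual psi ->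
    (forall w, W w -> `|chi w - 1| <= (1 / 4)%:C%C) ->
    (forall w, W w -> `|psi w - 1| <= (1 / 4)%:C%C) ->
    (forall a, a \in s -> `|chi a - psi a| <= (1 / 2)%:C%C) -> chi = psi.
Proof.
move=> sW dc dp cW pW cp.
suff /(congr1 (fun f => f _)) h : (fun x => chi x * psi (- x)) = cst 1.
  by apply/funext => x; rewrite -[LHS]mulr1 -[1](mulVf (dual_neq0 dp x)) mulrA -dualN// h mul1r.
apply: character_no_small_image; first by apply: dual_mul => //; exact: dual_opp.
move=> x; apply: near1_Re_ge0; have [a a_s Wa] := sW x.
have -> : chi x * psi (- x) - 1 = psi (- x) * (chi x - psi x).
  by rewrite mulrBr -dualD// addNr dual0// mulrC.
rewrite normrM dual_norm// mul1r.
have -> : chi x - psi x = chi a * (chi (x - a) - 1) + (chi a - psi a) -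
    psi a * (psi (x - a) - 1).
  by rewrite !mulrBr -!dualD// subrKC; ring.
rewrite [leRHS](_ : 1 = (1 / 4)%:C%C + (1 / 2)%:C%C + (1 / 4)%:C%C); last first.
  by rewrite -!rmorphD; congr (_%:C%C); field.
apply: (le_trans (ler_normB _ _)); apply: lerD; last by rewrite normrM dual_norm// [leLHS]mul1r pW.
by rewrite (le_trans (ler_normD _ _))// lerD// ?cp// normrM dual_norm// [leLHS]mul1r cW.
Qed.

(** Each character is within 1/4 of 1 on some ball of radius [1 / (n + 1)], so the classes [K n]
    exhaust the dual; within one class, rounded values on a finite net determine a character. *)
Lemma compact_dual_countable : countable (@dual R X).
Proof.
pose K n : set (X -> R[i]) := [set chi | dual chi /\
  forall x, d 0 x < n.+1%:R^-1 -> `|chi x - 1| <= (1 / 4)%:C%C].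
have dualK : @dual R X `<=` \bigcup_n K n.
  move=> chi dc; have [cc _ _] := dc.
  have e0 : 0 < (1 / 4 : R)%:C%C by rewrite ltcR; lra.
  have /cvgrPdist_le/(_ _ e0) := cc 0.
  move=> /(metric_nbhsP d_metric)[e /= e_gt0 eP].
  have /cvgrPdist_lt/(_ _ e_gt0)[n _ /(_ n (leqnn n))] := @cvg_harmonic R.
  rewrite /= sub0r normrN ger0_norm ?invr_ge0// => ne.
  exists n => //; split=> // x xn; rewrite distrC -(dual0 dc).
  by apply: eP; exact: lt_trans xn ne.
apply: sub_countable (subset_card_le dualK) _; apply: bigcup_countable => // n _.
pose W := [set x : X | d 0 x < n.+1%:R^-1].
have W0 : nbhs (0 : X) W.
  by apply/(metric_nbhsP d_metric); exists n.+1%:R^-1 => //; rewrite invr_gt0.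
have [|s sP] := compact_net (U := fun a => [set x | W (x - a)]) X_compact.
  by move=> a; exact: nbhs_subl.
(* The factor 4 makes the rounding error less than 1/4 in each part, hence less than 1/2 in
   modulus. *)
pose code (chi : X -> R[i]) : seq (int * int) :=
  [seq (Num.floor (4 * Re (chi a)), Num.floor (4 * Im (chi a))) | a <- s].
apply: (@sub_countable _ _ _ [set: seq (int * int)]); last exact: countableP.
apply: (injection_card_le (f := code)) => // chi psi /set_mem[dc cW] /set_mem[dp pW] cp.
apply: (close_characters_eq (W := W) (s := s)) => // a a_s.
have /(_ a a_s)[] : {in s, forall a,
    Num.floor (4 * Re (chi a)) = Num.floor (4 * Re (psi a)) /\
    Num.floor (4 * Im (chi a)) = Num.floor (4 * Im (psi a))}.
  by move=> b bs; have /eq_in_map/(_ b bs)[-> ->] := cp.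
move=> /floor_near + /floor_near; rewrite -!mulrBr !normrM ger0_norm// => hr hi.
apply/ltW/(normc_bounds _ _).2; first lra.
- rewrite (_ : Re _ = Re (chi a) - Re (psi a)); first lra.
  by case: (chi a) (psi a) => [? ?] [? ?].
- rewrite (_ : Im _ = Im (chi a) - Im (psi a)); first lra.
  by case: (chi a) (psi a) => [? ?] [? ?].
Qed.

Lemma finsupp_dual_countable : countable (@finsupp_dual R X).
Proof.
have /countable_injP[f f_inj] := compact_dual_countable.
(* A left inverse of [f] on characters, with the trivial character as default value. *)
pose e n : X -> R[i] := xget (cst 1) [set chi | dual chi /\ f chi = n].
have ef chi : dual chi -> e (f chi) = chi.
  move=> dc; rewrite /e; case: xgetP => [psi _ [dp]|/(_ chi)/not_andP[]//].
  by apply: f_inj; exact: mem_set.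
pose g (l : seq nat) : nat -> X -> R[i] := fun n => if (n < size l)%N then e (nth 0%N l n) else cst 1.
apply: (@sub_countable _ _ _ (range g)); last first.
  by apply: sub_countable (card_image_le _ _) (countableP _).
apply: subset_card_le => h [dh /finite_seqP[s sE]].
exists (mkseq (fun n => f (h n)) (\max_(i <- s) i).+1) => //.
apply/funext => n; rewrite /g size_mkseq; case: ltnP => [nN|].
  by rewrite nth_mkseq// ef.
move=> nN; apply: esym; apply: contrapT => hn.
have : [set n | h n <> cst 1] n by [].
by rewrite sE /= => ns; have := @leq_bigmax_seq nat s xpredT (fun i => i) n ns isT; rewrite leqNgt nN.
Qed.

(** Surjectivity gives countability; one nontrivial character of [X], composed with each projection,
    gives infinitely many elements. *)
Lemma finsupp_dual_surj_card (a : X) : a <> 0 ->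
  set_surj (@finsupp_dual R X) (@dual R (c0 X)) (@chi_of R X) ->
  @dual R (c0 X) #= [set: nat].
Proof.
move=> a0 surj; apply: eq_card_nat.
  apply: sub_countable (subset_card_le surj) _.
  exact: sub_countable (card_image_le _ _) finsupp_dual_countable.
have [xi dxi xia] := character_point_separation X_compact d_metric a0.
apply/infiniteP; apply: (injection_card_le (f := fun n (x : c0 X) => xi (val x n))).
  move=> n m _ _ /(congr1 (fun f => f (single a n))); rewrite !singleE eqxx.
  by case: eqP => // _; rewrite dual0// => /xia.
by move=> n _; exact: dual_proj.
Qed.

End compact_metric.
End cardinality.

(** * Null sequences in a disconnected group *)

Section disconnected_case.
Variables (R : realType) (X : topologicalZmodType).
Hypothesis X_compact : compact [set: X].

(* The translations preserving a clopen set form an open subgroup, proper when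
   the set is; the character is nontrivial and factors through the quotient. *)
Lemma clopen_character (B : set X) : clopen B -> B !=set0 -> B <> [set: X] ->
  exists2 xi : X -> R[i], dual xi & (exists a, xi a <> 1) /\
    nbhs (0 : X) [set w | xi w = 1].
Proof.
move=> [Bo Bc] [c Bx] BT.
have [y By] : exists y, ~ B y.
  by apply/existsNP => h; apply: BT; apply/seteqP; split.
pose f x : R := if `[< B x >] then 1 else 0.
have cf : continuous f.
  move=> x; apply/cvgrPdist_le => e e0; have [Bx'|Bx'] := pselect (B x).
    have : nbhs x B by exact: open_nbhs_nbhs.
    by apply: filterS => z Bz; rewrite /f !asboolT// subrr normr0 ltW.
  have : nbhs x (~` B) by apply: open_nbhs_nbhs; split=> //; exact: closed_openC.
  by apply: filterS => z Bz; rewrite /f !asboolF// subrr normr0 ltW.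
(* [f] takes only the values 0 and 1, so a variation of at most 1/2 is no variation at all. *)
have e20 : 0 < 1 / 2 :> R by [].
have [W W0 WP] := uniform_continuity X_compact cf e20.
pose H := [set p | forall x, B (x + p) <-> B x].
have WH w : W w -> H w.
  move=> Ww x; have := WP w x Ww; rewrite /f.
  case: asboolP => B1; case: asboolP => B2 //.
    by rewrite subr0 normr1 ler_pdivlMr// mul1r lern1.
  by rewrite sub0r normrN normr1 ler_pdivlMr// mul1r lern1.
have HN p : H p -> H (- p) by move=> Hp x; rewrite -(Hp (x - p)) subrK.
have HD p q : H p -> H q -> H (p + q) by move=> Hp Hq x; rewrite addrA Hq Hp.
(* The indicator of [H] is even and has all of [H] as periods, so the character built from it is
   trivial on [H], hence near 0. It is nontrivial at [y - c], which carries [c] in [B] to [y]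
   outside [B]. *)
pose h p : R := if `[< H p >] then 1 else 0.
have hD x p : H p -> h (x + p) = h x.
  move=> Hp; rewrite /h; case: (asboolP (H x)) => Hx; first by rewrite asboolT//; exact: HD.
  by rewrite asboolF// => Hxp; apply: Hx; rewrite -(addrK p x); exact/HD/HN.
have ch : continuous h.
  apply: continuous_translation => e e0; exists W => // w x /WH /hD ->.
  by rewrite subrr normr0 ltW.
have hN x : h (- x) = h x.
  rewrite /h; case: (asboolP (H x)) => Hx; first by rewrite asboolT//; exact: HN.
  by rewrite asboolF// => /HN; rewrite opprK.
have [|xi [dxi xic xip]] := character_separates X_compact ch hN (x0 := y - c).
  rewrite /h asboolF; last by move=> /(_ c); rewrite subrKC => -[_ /(_ Bx)].
  by rewrite asboolT; [rewrite eq_sym oner_neq0|move=> x; rewrite addr0].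
exists xi => //; split; first by exists (y - c).
by apply: filterS W0 => w /WH Hw; apply: xip => x; exact: hD.
Qed.

Section subset_characters.
Variables (xi : X -> R[i]) (a : X).
Hypothesis xi_dual : dual xi.
Hypothesis xi_open : nbhs (0 : X) [set w | xi w = 1].
Hypothesis xi_neq1 : xi a <> 1.

Let component (S : set nat) n := if `[< S n >] then xi else cst 1.

(** For infinite [S] infinitely many components are nontrivial. Still, [xi] is trivial near 0 and
    [x] tends to 0, so for each [x] almost all factors are 1. *)
Definition subset_character (S : set nat) : c0 X -> R[i] := chi_of (component S).

Let component_dual S n : dual (component S n).
Proof. by rewrite /component; case: ifP => // _; exact: dual1. Qed.

Lemma subset_characterE S (x : c0 X) N :
  (forall n, (N <= n)%N -> xi (val x n) = 1) ->
  subset_character S x = \prod_(n < N) component S n (val x n).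
Proof. by move=> xN; rewrite /subset_character (chi_ofE (N := N))// /component => n /xN xn; case: ifP. Qed.

Lemma subset_character_support (x : c0 X) :
  exists N, forall n, (N <= n)%N -> xi (val x n) = 1.
Proof. exact: c0_cvg xi_open. Qed.

Lemma subset_character_dual S : dual (subset_character S).
Proof.
have psiD (x y : c0 X) : subset_character S (x + y) = subset_character S x * subset_character S y.
  have [N NP] := subset_character_support x; have [M MP] := subset_character_support y.
  rewrite !(@subset_characterE _ _ (maxn N M)).
  - by rewrite -big_split/=; apply: eq_bigr => i _; exact: dualD (component_dual S i) _ _.
  - by move=> n; rewrite geq_max => /andP[_ /MP].
  - by move=> n; rewrite geq_max => /andP[/NP].
  - move=> n; rewrite geq_max c0D dualD// => /andP[/NP -> /MP ->].
    by rewrite mulr1.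
split=> // [x A xA|x].
  (* The character is locally constant: it does not change when every coordinate moves within the
     kernel of [xi]. *)
  apply/c0_nbhsP; exists [set w | xi w = 1] => // y xy.
  rewrite /preimage /= (_ : subset_character S y = subset_character S x).
    exact: nbhs_singleton xA.
  rewrite -(subrKC x y) psiD (@subset_characterE _ (y - x) 0) => [|n _]; last exact: xy.
  by rewrite big_ord0 mulr1.
have [N NP] := subset_character_support x.
rewrite /circle /= (subset_characterE _ NP) normr_prod big1// => i _.
exact: dual_norm.
Qed.

Lemma subset_character_inj : injective subset_character.
Proof.
suff sub S S' : subset_character S = subset_character S' -> S `<=` S'.
  by move=> S S' SS'; apply/seteqP; split; apply: sub.
move=> SS' n Sn; apply: contrapT => S'n; apply: xi_neq1.
have vE U : subset_character U (single a n) = component U n a.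
  rewrite (@subset_characterE _ _ n.+1) => [|m nm]; last first.
    by rewrite singleE gtn_eqF// dual0.
  rewrite big_ord_recr/= big1 ?mul1r => [|i _]; last first.
    by rewrite ltnS (ltnW (ltn_ord i)) ltn_eqF// dual0.
  by rewrite ltnSn eqxx.
have := congr1 (fun psi => psi (single a n)) SS'; rewrite !vE /component.
by rewrite asboolT// asboolF.
Qed.

End subset_characters.

(** The lower Dedekind cut of [r], its rationals coded as naturals. It maps reals to index sets of
    the characters above, so the lower bound on the dual is stated with [R] itself. *)
Definition cut (r : R) : set nat := [set n | exists2 q : rat, pickle q = n & ratr q < r].

Lemma cut_inj : injective cut.
Proof.
suff le (r s : R) : cut r = cut s -> r <= s.
  by move=> r s rs; apply/eqP; rewrite eq_le !le.
move=> rs; rewrite leNgt; apply/negP => /rat_in_itvoo[q].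
rewrite in_itv/= => /andP[sq qr].
have : cut r (pickle q) by exists q.
rewrite rs => -[q' /(pcan_inj pickleK) -> ]; rewrite ltNge.
by rewrite (ltW sq).
Qed.

Lemma disconnected_dual_large (B : set X) : clopen B -> B !=set0 -> B <> [set: X] ->
  [set: R] #<= @dual R (c0 X).
Proof.
move=> cB B0 BT; have [xi dxi [[a xia] xio]] := clopen_character cB B0 BT.
apply: (injection_card_le (f := fun r => subset_character xi (cut r))).
  by move=> r s _ _ /(subset_character_inj dxi xia)/cut_inj.
by move=> r _; exact: subset_character_dual.
Qed.

(** A proper nonempty clopen set would inject the reals into the dual, and Cantor-Bernstein with the
    assumed upper bound would give the excluded equality. *)
Lemma small_dual_connected :
  @dual R (c0 X) #<= [set: R] /\ ~ (@dual R (c0 X) #= [set: R]) ->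
  connected [set: X].
Proof.
move=> [DR nDR] B B0 [C Co BC] [D Dc BD]; apply: contrapT => BT; apply: nDR.
rewrite setTI in BC; rewrite setTI in BD.
apply: Cantor_Bernstein => //; apply: (disconnected_dual_large (B := B)) => //.
by split; [rewrite BC|rewrite BD].
Qed.

End disconnected_case.

Theorem mainTheorem2 (R : realType) (X : topologicalZmodType)
    (X_infinite : infinite_set [set: X])
    (X_compact : compact [set: X])
    (X_metrizable : metrizable R X) :
  [/\ ~ precompact_group (c0 X),
      locally_quasi_convex R (c0 X) &
      polish R (c0 X)] /\
  [<-> connected [set: X];
       set_surj (@finsupp_dual R X) (@dual R (c0 X)) (@chi_of R X);
       @dual R (c0 X) #= [set: nat];
       @dual R (c0 X) #<= [set: R] /\ ~ (@dual R (c0 X) #= [set: R])].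
Proof.
have [d d_metric] := X_metrizable.
have [a a0] : exists a : X, a <> 0.
  apply: contrapT => /forallNP h; apply: X_infinite.
  by apply: sub_finite_set (finite_set1 (0 : X)) => x _; apply: contrapT => /h.
split; first split.
- apply: (@c0_not_precompact _ a [set x | d 0 x < d 0 a]); last by rewrite /= ltxx.
  apply/(metric_nbhsP d_metric); exists (d 0 a) => //.
  by apply: (metric_gt0 d_metric) => /esym.
- exact: c0_locally_quasi_convex d_metric.
- exact: c0_polish d_metric.
tfae.
- exact: connected_dual_finsupp.
- exact: finsupp_dual_surj_card d_metric _ a0.
- exact: countable_small_card.
- exact: small_dual_connected.
Qed.
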